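(* Let $G$ be an edge-independent random graph on $[n]$ with expected adjacency matrix $\bar A$, Laplacian $L$, expected Laplacian $\bar L$ and minimum expected degree $\delta=\min_{1\le i\le n}\sum_{j=1}^n p_{ij}$, and let $k=\mathrm{rank}(\bar A)$. If $\delta\gg\max\{k,\ln^4 n\}$, then almost surely $$|\lambda_i(L)-\lambda_i(\bar L)|\le\frac{2+\sqrt{k}+o(1)}{\sqrt{\delta}}\qquad\text{for } 1\le i\le n.$$
   Context: Edge-independent random graph: for each $n$ we are given numbers $p_{ij}=p_{ji}\in[0,1]$ ($1\le i,j\le n$), not assumed equal and allowed to depend on $n$. The random graph $G$ has vertex set $[n]=\{1,\dots,n\}$, and each pair $\{i,j\}$, $i\le j$, is an edge with probability $p_{ij}$, independently of all other pairs; $X_{ij}=X_{ji}$ is the indicator of $\{i,j\}$ being an edge (the case $i=j$ is a loop). $A=(X_{ij})$ is the adjacency matrix and $\bar A=\mathrm{E}(A)=(p_{ij})$. The degree of $i$ is $d_i=\sum_{j=1}^n X_{ij}$ and its expected degree is $t_i=\sum_{j=1}^n p_{ij}$; $D$ and $T$ are the diagonal matrices with $D_{ii}=d_i$, $T_{ii}=t_i$. The normalized Laplacian is $L=I-D^{-1/2}AD^{-1/2}$ (with $(D^{-1/2})_{ii}=0$ if $d_i=0$), and the expected Laplacian is $\bar L=I-T^{-1/2}\bar A T^{-1/2}$. For an $n\times n$ symmetric matrix $M$, $\lambda_1(M)\le\dots\le\lambda_n(M)$ are its eigenvalues in non-decreasing order, with multiplicity. All quantities (including $k$) depend on $n$ and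 asymptotics are as $n\to\infty$: $f\gg h$ means $f(n)/h(n)\to\infty$, $o(1)$ is a deterministic quantity tending to $0$ (uniform in $i$), and ''almost surely'' means with probability tending to $1$ as $n\to\infty$. *)

(* Defs.v *)
From mathcomp Require Import all_boot all_order all_algebra.
From mathcomp Require Import polyrcf.
From mathcomp Require Import all_classical all_reals all_analysis.

Set Implicit Arguments.
Unset Strict Implicit.
Unset Printing Implicit Defensive.

Import Order.TTheory GRing.Theory Num.Theory.
Import numFieldNormedType.Exports.

Local Open Scope classical_set_scope.
Local Open Scope ring_scope.

(* Used both for the 0/1 adjacency matrix of a graph, giving the degrees d_i, *)
(* and for the matrix (p_ij), giving the expected degrees t_i.                *)
Definition degree (R : realType) (n : nat) (M : 'M[R]_n) (i : 'I_n) : R :=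
  \sum_j M i j.

(* A vertex of degree 0 gets the entry 0, since Num.sqrt 0 = 0 and 0^-1 = 0.  *)
Definition inv_sqrt_degrees (R : realType) (n : nat) (M : 'M[R]_n) : 'M[R]_n :=
  diag_mx (\row_i (Num.sqrt (degree M i))^-1).

Definition laplacian (R : realType) (n : nat) (M : 'M[R]_n) : 'M[R]_n :=
  1%:M - inv_sqrt_degrees M *m M *m inv_sqrt_degrees M.

(* The base value n%:R of the minimum is inert for n > 0: with entries in     *)
(* [0, 1] every degree is at most n.                                          *)
Definition min_degree (R : realType) (n : nat) (M : 'M[R]_n) : R :=
  \big[Num.min/n%:R]_(i < n) degree M i.

(* rootsR lists the distinct real roots in increasing order; each is repeated *)
(* with its multiplicity in the characteristic polynomial.  For a symmetric   *)
(* matrix of order n, this sequence has size n.                               *)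
Definition eigenvalues (R : realType) (n : nat) (M : 'M[R]_n) : seq R :=
  flatten [seq nseq (mup x (char_poly M)) x | x <- rootsR (char_poly M)].

(* lambda M i is the (i+1)-st smallest eigenvalue, as 'I_n starts at 0.       *)
Definition lambda (R : realType) (n : nat) (M : 'M[R]_n) (i : 'I_n) : R :=
  (eigenvalues M)`_i.

(* A graph on 'I_n, loops allowed, is given by its symmetric edge relation.   *)
Definition is_graph (n : nat) (G : 'M[bool]_n) : bool := G^T == G.

Definition adjacency (R : realType) (n : nat) (G : 'M[bool]_n) : 'M[R]_n :=
  \matrix_(i, j) (G i j)%:R.

(* Probability of drawing exactly G when the pairs {i, j}, i <= j, are        *)
(* independently edges with probabilities p i j.                              *)
Definition graph_weight (R : realType) (n : nat) (p : 'M[R]_n)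
    (G : 'M[bool]_n) : R :=
  \prod_(e : 'I_n * 'I_n | (e.1 <= e.2)%N)
    (if G e.1 e.2 then p e.1 e.2 else 1 - p e.1 e.2).

Definition graph_prob (R : realType) (n : nat) (p : 'M[R]_n)
    (E : pred 'M[bool]_n) : R :=
  \sum_(G : 'M[bool]_n | is_graph G && E G) graph_weight p G.

Definition much_larger (R : realType) (f h : nat -> R) : Prop :=
  f n / h n @[n --> \oo] --> +oo.

(* Main.v *)
From mathcomp Require Import all_boot all_order all_algebra perm.
From mathcomp Require Import polyrcf complex ring lra zify.
From mathcomp Require Import all_classical all_reals all_analysis.
Require Import Defs.
Import Order.TTheory GRing.Theory Num.Theory.
Import numFieldNormedType.Exports.
Local Open Scope ring_scope.
Set Implicit Arguments.
Unset Strict Implicit.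
Unset Printing Implicit Defensive.

(** Write [t_i] and [d_i] for the expected and actual degrees, [N] for the
normalized expected matrix [T^(-1/2) p T^(-1/2)], [C] for the normalized noise
[T^(-1/2) (A - p) T^(-1/2)] and [q_i = sqrt (t_i / d_i)].  By Weyl's inequality
([weyl]) it is enough to bound the quadratic form of
  [L - Lbar = N - q (C + N) q],
whose entries are [- q_i q_j C_ij - N_ij (q_i q_j - 1)].  To first order in the
relative fluctuations [u_i = (d_i - t_i) / t_i], [q_i q_j - 1] is
[- (u_i + u_j) / 2], so three terms have to be controlled
([laplacian_perturbation]).

The noise [q C q].  A Chernoff bound makes all [u_i] small, so that [q] is close
to the identity, and it remains to show that [C] has norm at most
[(2 + o(1)) / sqrt delta].  This is the trace method ([trace_bound]), applied to
[H = sqrt delta C]: its entries are at most [K = 1 / sqrt delta], and the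
variances in a row sum to at most 1.  The expected trace of [H ^ m] is a sum over
closed walks, where only walks using no edge exactly once contribute.  Instead of
counting walk shapes, the sum is bounded by induction along the walk.  A step to
a new vertex opens an edge and costs its variance, so these steps have total
weight at most 1; traversing an open edge for the second time closes it and costs
nothing more; every other step leads to one of at most [m + 1] visited vertices
and costs [K].  A closing step is ambiguous only when several open edges meet at
the current vertex, and a potential, the excess of open degrees, falls at each
ambiguous step and rises only at steps of the third kind.  Charging a factor
[B = m + 1] per unit of excess makes the whole sum grow by a factor
[2 + B^2 K] per step ([walk_bound]).  Taking [m] of order [ln n] gives the
constant 2, since [delta] dominates [ln^4 n] and therefore [B^2 K] tends to 0.

The first order term.  Its norm is at most the Frobenius norm [sqrt Y] with
[Y = sum_i w_i u_i^2], where [w_i] is the squared norm of row [i] of [N].  As [N]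
has norm at most 1 and rank [k], the [w_i] sum to at most [k]
([frobenius_le_rank]), so [Y] has mean at most [k / delta]; its variance is
[O(k / delta^3)] because the fluctuations of two degrees share a single edge
([gexp_weighted_fluctuation2]).  As [delta] dominates [k], Chebyshev's inequality
gives [sqrt Y <= (sqrt k + o(1)) / sqrt delta].

The remainder.  It is of second order in [u], with squared Frobenius norm
[O(sum_i w_i u_i^4)], which has mean [O(k / delta^2)] and hence is [o(1 / delta)]
with high probability.

All estimates are quantitative at fixed [n] ([failure_probability]).  They show
that for every fixed [eps] the bound with error [eps] fails with probability
tending to 0, and a diagonal extraction ([vanishing_error]) produces the
error sequence. *)

(** * Spectral theorem for real symmetric matrices *)

Section Spectral.
Context {R : realType}.

Definition dotv n (x y : 'rV[R]_n) : R := \sum_i x 0 i * y 0 i.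

Definition qform n (M : 'M[R]_n) (x : 'rV[R]_n) : R := (x *m M *m x^T) 0 0.

Lemma dotvE n (x y : 'rV[R]_n) : (x *m y^T) 0 0 = dotv x y.
Proof. by rewrite mxE; apply: eq_bigr => i _; rewrite mxE. Qed.

Lemma dotv_ge0 n (x : 'rV[R]_n) : 0 <= dotv x x.
Proof. by apply: sumr_ge0 => i _; rewrite -expr2 sqr_ge0. Qed.

Lemma dotv_eq0 n (x : 'rV[R]_n) : (dotv x x == 0) = (x == 0).
Proof.
apply/eqP/eqP => [x0|->]; last by apply: big1 => i _; rewrite mxE mul0r.
apply/rowP => i; rewrite mxE; apply/eqP; rewrite -[_ == 0]orbb -mulf_eq0.
move: x0 => /eqP; rewrite psumr_eq0 => [/allP/(_ i)|j _]; last first.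
  by rewrite -expr2 sqr_ge0.
by rewrite mem_index_enum => /(_ isT) /=.
Qed.

Lemma qformE n (M : 'M[R]_n) x : qform M x = \sum_i \sum_j M i j * (x 0 i * x 0 j).
Proof.
rewrite /qform mxE exchange_big /=; apply: eq_bigr => j _; rewrite !mxE mulr_suml.
by apply: eq_bigr => i _; ring.
Qed.

Lemma dotvC n (x y : 'rV[R]_n) : dotv x y = dotv y x.
Proof. by apply: eq_bigr => i _; rewrite mulrC. Qed.

Lemma dotvDl n (x y z : 'rV[R]_n) : dotv (x + y) z = dotv x z + dotv y z.
Proof. by rewrite -big_split; apply: eq_bigr => i _; rewrite mxE mulrDl. Qed.

Lemma dotvZl n a (x z : 'rV[R]_n) : dotv (a *: x) z = a * dotv x z.
Proof. by rewrite mulr_sumr; apply: eq_bigr => i _; rewrite mxE mulrA. Qed.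

Lemma dotv_mulmx n (M : 'M[R]_n) x y : dotv (x *m M) y = dotv x (y *m M^T).
Proof. by rewrite -!dotvE trmx_mul trmxK mulmxA. Qed.

(** A complex eigenvector [x + i y] for the eigenvalue [a + i b] satisfies
[x M = a x - b y] and [y M = a y + b x]; symmetry of [M] then gives
[b (|x|^2 + |y|^2) = 0], so the eigenvalue is real and [x] or [y] is an
eigenvector. *)
Lemma symmetric_eigenvector n (M : 'M[R]_n.+1) : M^T = M ->
  exists l (v : 'rV[R]_n.+1), v *m M = l *: v /\ dotv v v = 1.
Proof.
move=> sM; pose A := map_mx (real_complex R) M.
have [[a b] /eigenvalueP [v vA v0]] := eigenvalue_closed A (ltn0Sn n).
pose x := map_mx (@complex.Re R) v; pose y := map_mx (@complex.Im R) v.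
have Ex : x *m M = a *: x - b *: y.
  apply/rowP => j; move/rowP: vA => /(_ j) /(congr1 (@complex.Re R)).
  rewrite !mxE raddf_sum /= => E.
  transitivity (complex.Re ((a +i* b)%C * v 0 j)).
    rewrite -E; apply: eq_bigr => i _; rewrite !mxE.
    by case: (v 0 i) => c d /=; ring.
  by case: (v 0 j) => c d /=.
have Ey : y *m M = a *: y + b *: x.
  apply/rowP => j; move/rowP: vA => /(_ j) /(congr1 (@complex.Im R)).
  rewrite !mxE raddf_sum /= => E.
  transitivity (complex.Im ((a +i* b)%C * v 0 j)).
    rewrite -E; apply: eq_bigr => i _; rewrite !mxE.
    by case: (v 0 i) => c d /=; ring.
  by case: (v 0 j) => c d /=.
have xy0 : (x != 0) || (y != 0).
  apply: contraNT v0; rewrite negb_or !negbK => /andP [/eqP/rowP x0 /eqP/rowP y0].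
  apply/eqP/rowP => j; move: (x0 j) (y0 j); rewrite !mxE.
  by case: (v 0 j) => c d /= -> ->.
have b0 : b = 0.
  have := dotv_mulmx M x y; rewrite sM Ex Ey -scaleNr dotvDl !dotvZl.
  rewrite (dotvC x (_ + _)) dotvDl !dotvZl (dotvC y x) => E.
  have : b * (dotv x x + dotv y y) = 0 by lra.
  move/eqP; rewrite mulf_eq0 => /orP [/eqP //|].
  by rewrite paddr_eq0 ?dotv_ge0// !dotv_eq0 => /andP [] x0 y0; rewrite x0 y0 in xy0.
rewrite b0 !scale0r ?subr0 ?addr0 in Ex Ey.
have [z [zM z0]] : exists z : 'rV[R]_n.+1, z *m M = a *: z /\ z != 0.
  by case/orP: xy0 => ?; [exists x | exists y].
have z1 : 0 < dotv z z by rewrite lt_neqAle dotv_ge0 eq_sym dotv_eq0 z0.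
exists a, ((Num.sqrt (dotv z z))^-1 *: z); split.
  by rewrite -scalemxAl zM !scalerA mulrC.
rewrite dotvZl dotvC dotvZl mulrA -expr2 exprVn sqr_sqrtr ?ltW//.
by rewrite mulVf ?gt_eqF.
Qed.

(** The Householder reflection in the hyperplane orthogonal to [v - e_0]
exchanges [e_0] and [v], so every unit vector is the first row of a symmetric
orthogonal matrix. *)
Lemma householder n (v : 'rV[R]_n.+1) : dotv v v = 1 ->
  exists H : 'M[R]_n.+1, [/\ H^T = H, H *m H = 1%:M & row 0 H = v].
Proof.
move=> v1; pose e : 'rV[R]_n.+1 := delta_mx 0 0; pose w := v - e.
have ee : dotv e e = 1.
  by rewrite /dotv (bigD1 0) //= big1 ?mxE ?eqxx ?mulr1 ?addr0// => i /negPf i0;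
     rewrite !mxE i0 andbF mulr0.
have [->|vNe] := eqVneq v e.
  exists 1%:M; split; rewrite ?trmx1 ?mulmx1//.
  by rewrite rowE mulmx1.
have w0 : dotv w w != 0 by rewrite dotv_eq0 subr_eq0.
have ew : dotv w w = - (dotv e w *+ 2).
  rewrite /w -scaleN1r dotvDl !dotvZl !(dotvC _ (_ + _)) !dotvDl !dotvZl v1 ee.
  by rewrite (dotvC e v) mulr2n; ring.
have ww : w *m w^T = (dotv w w)%:M by rewrite [LHS]mx11_scalar dotvE.
pose c := 2 / dotv w w; pose W := w^T *m w.
have WW : W *m W = dotv w w *: W.
  by rewrite /W mulmxA -(mulmxA w^T) ww mul_mx_scalar -scalemxAl.
exists (1%:M - c *: W); split.
- by rewrite linearB linearZ /= trmx1 trmx_mul trmxK.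
- rewrite mulmxBl mul1mx mulmxBr mulmx1 -scalemxAr -scalemxAl WW !scalerA.
  apply/matrixP => i j; rewrite !mxE /c; move: (W i j) => Wij; field; exact: w0.
- rewrite rowE mulmxBr mulmx1 -scalemxAr /W mulmxA [e *m _]mx11_scalar dotvE.
  rewrite mul_scalar_mx scalerA (_ : c * _ = -1).
    by rewrite scaleN1r opprK addrC subrK.
  by rewrite /c ew; field; move: w0; rewrite ew oppr_eq0 mulrn_eq0.
Qed.

(** Conjugating by a reflection whose first row is an eigenvector splits off a
1 by 1 block; the induction continues on the complementary block. *)
Lemma spectral_unsorted n (M : 'M[R]_n) : M^T = M ->
  exists P (d : 'rV[R]_n), P *m P^T = 1%:M /\ M = P^T *m diag_mx d *m P.
Proof.
elim: n M => [|n IH] M sM.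
  by exists 1%:M, 0; split; apply/matrixP; case.
have [l [v [vM v1]]] := symmetric_eigenvector sM.
have [H [sH HH rH]] := householder v1.
pose A := H *m M *m H.
have sA : A^T = A by rewrite /A !trmx_mul sH sM mulmxA.
have rA : row 0 A = l *: row 0 (1%:M).
  rewrite /A !row_mul rH vM -scalemxAl -[v]rH -row_mul HH //.
pose A' := drsubmx (A : 'M[R]_(1 + n)).
have sA' : A'^T = A' by rewrite /A' trmx_drsub sA.
have [P' [d' [P'P' eA']]] := IH _ sA'.
pose Q : 'M[R]_(1 + n) := block_mx 1%:M 0 0 P'.
pose d : 'rV[R]_(1 + n) := row_mx l%:M d'.
have eA : A = Q^T *m diag_mx d *m Q.
  rewrite /Q /d diag_mx_row tr_block_mx !trmx0 trmx1 !mulmx_block.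
  rewrite !(mul0mx, mulmx0, addr0, add0r, mul1mx, mulmx1) -eA'.
  rewrite -[LHS](@submxK _ 1 n 1 n).
  have r0 i : A 0 i = l *+ (0 == i).
    by move/rowP: rA => /(_ i); rewrite [LHS]mxE => ->; rewrite !mxE mulr_natr.
  have -> : ulsubmx (A : 'M[R]_(1 + n)) = diag_mx l%:M.
    by apply/matrixP => i j; rewrite [LHS]mxE [LHS]mxE !ord1 lshift0 r0 !mxE.
  have -> : ursubmx (A : 'M[R]_(1 + n)) = 0.
    by apply/matrixP => i j; rewrite [LHS]mxE [LHS]mxE !ord1 lshift0 r0 mxE.
  have -> // : dlsubmx (A : 'M[R]_(1 + n)) = 0.
  apply/matrixP => i j; rewrite -sA [LHS]mxE [LHS]mxE [LHS]mxE !ord1.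
  by rewrite lshift0 r0 mxE.
have QQ : Q *m Q^T = 1%:M.
  rewrite /Q tr_block_mx !trmx0 trmx1 mulmx_block.
  by rewrite !(mul0mx, mulmx0, addr0, add0r, mul1mx, mulmx1) P'P' -scalar_mx_block.
exists (Q *m H), d; split.
  rewrite trmx_mul sH mulmxA -(mulmxA Q) HH mulmx1; exact: QQ.
rewrite trmx_mul sH !mulmxA -(mulmxA H) -(mulmxA H) -eA /A !mulmxA HH mul1mx.
by rewrite -mulmxA HH mulmx1.
Qed.
End Spectral.

(** * Eigenvalues, perturbation and traces *)

Section SpectralConsequences.
Context {R : realType}.

Lemma spectral_theorem n (M : 'M[R]_n) : M^T = M ->
  exists P (d : 'rV[R]_n),
    [/\ P *m P^T = 1%:M, M = P^T *m diag_mx d *m P &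
        forall i j : 'I_n, (i <= j)%N -> d 0 i <= d 0 j].
Proof.
move=> /spectral_unsorted [P [d [PP eM]]].
pose t := [tuple d 0 i | i < n].
have /tuple_permP [s es] : perm_eq (sort <=%R t) t by rewrite perm_sort.
have nth_s (i : 'I_n) : nth 0 (sort <=%R t) i = d 0 (s i).
  by rewrite es -tnth_nth tnth_mktuple tnth_mktuple.
exists (row_perm s P), (col_perm s d); split.
- apply/matrixP => i j; move/matrixP: PP => /(_ (s i) (s j)); rewrite !mxE.
  rewrite (inj_eq perm_inj) => <-.
  by apply: eq_bigr => k _; rewrite !mxE.
- rewrite {1}eM; apply/matrixP => i j; rewrite !mxE (reindex_perm s) /=.
  by apply: eq_bigr => k _; rewrite !mul_mx_diag !mxE.
- move=> i j ij; rewrite !mxE -!nth_s.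
  apply: le_sorted_leq_nth => //; first exact: sort_le_sorted.
  all: by rewrite inE size_sort size_tuple.
Qed.

Lemma char_poly_orthogonal n (P : 'M[R]_n) (d : 'rV[R]_n) : P *m P^T = 1%:M ->
  char_poly (P^T *m diag_mx d *m P) = \prod_i ('X - (d 0 i)%:P).
Proof.
move=> PP; have P'P : P^T *m P = 1%:M by apply/mulmx1C.
transitivity (char_poly (diag_mx d)).
  rewrite /char_poly /char_poly_mx !map_mxM /=.
  have e : ('X%:M : 'M[{poly R}]_n) = map_mx polyC P^T *m 'X%:M *m map_mx polyC P.
    by rewrite mul_mx_scalar -scalemxAl -map_mxM P'P map_mx1 scalemx1.
  rewrite {1}e -mulmxBl -mulmxBr !det_mulmx mulrAC -det_mulmx -map_mxM P'P.
  by rewrite map_mx1 det1 mul1r.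
rewrite char_poly_trig ?diag_mx_is_trig//.
by apply: eq_bigr => i _; rewrite !mxE eqxx mulr1n.
Qed.

Lemma sorted_flatten_nseq (m : R -> nat) (s : seq R) : sorted <%R s ->
  sorted <=%R (flatten [seq nseq (m x) x | x <- s]).
Proof.
rewrite (sorted_pairwise lt_trans) (sorted_pairwise le_trans).
elim: s => //= x s IH /andP [xs /IH {}IH]; rewrite pairwise_cat IH andbT.
apply/andP; split.
  apply/allrelP => a b /nseqP [-> _] /flattenP [u /mapP [y ys ->] /nseqP [-> _]].
  by apply/ltW/(allP xs).
by elim: (m x) => //= k ->; rewrite andbT; apply/allP => y /nseqP [->].
Qed.

Lemma count_flatten_nseq (m : R -> nat) (s : seq R) y : uniq s ->
  count_mem y (flatten [seq nseq (m x) x | x <- s]) = if y \in s then m y else 0%N.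
Proof.
elim: s => // x s IH /andP [xs us]; rewrite [flatten _]/= count_cat IH //.
rewrite count_nseq in_cons /= [x == y]eq_sym.
have [->|_] := eqVneq y x; last by rewrite mul0n.
by rewrite (negPf xs) mul1n addn0.
Qed.

Lemma eigenvalues_orthogonal n (P : 'M[R]_n) (d : 'rV[R]_n) : P *m P^T = 1%:M ->
  (forall i j : 'I_n, (i <= j)%N -> d 0 i <= d 0 j) ->
  eigenvalues (P^T *m diag_mx d *m P) = [seq d 0 i | i <- enum 'I_n].
Proof.
move=> PP dh; rewrite /eigenvalues char_poly_orthogonal //.
set p := \prod_i _.
have ep : p = \prod_(x <- [seq d 0 i | i <- enum 'I_n]) ('X - x%:P).
  by rewrite big_map enumT.
have p0 : p != 0 by rewrite monic_neq0 // monic_prod_XsubC.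
have sr : sorted <%R (rootsR p) by exact: sorted_roots.
apply: le_sorted_eq.
- exact: sorted_flatten_nseq.
- have : sorted (relpre val leq) (enum 'I_n).
    by rewrite -sorted_map val_enum_ord iota_sorted.
  move=> se; rewrite sorted_map; apply: sub_sorted se => i j /=; exact: dh.
apply/allP => y _ /=; apply/eqP.
rewrite count_flatten_nseq; last exact: (sorted_uniq lt_trans ltxx).
rewrite -(roots_on_rootsR p0) in_itv /=.
case: ifPn => [_|/mupNroot yp]; first by rewrite ep mu_prod_XsubC.
by rewrite -[LHS]yp ep mu_prod_XsubC.
Qed.

Lemma lambda_orthogonal n (P : 'M[R]_n) (d : 'rV[R]_n) i : P *m P^T = 1%:M ->
  (forall i j : 'I_n, (i <= j)%N -> d 0 i <= d 0 j) ->
  lambda (P^T *m diag_mx d *m P) i = d 0 i.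
Proof.
move=> PP dh; rewrite /lambda eigenvalues_orthogonal //.
by rewrite (nth_map i) ?size_enum_ord // nth_ord_enum.
Qed.

Lemma qform_orthogonal n (P : 'M[R]_n) (d : 'rV[R]_n) x :
  qform (P^T *m diag_mx d *m P) x = \sum_j d 0 j * (x *m P^T) 0 j ^+ 2.
Proof.
rewrite /qform !mulmxA -(mulmxA _ P).
have -> : P *m x^T = (x *m P^T)^T by rewrite trmx_mul trmxK.
by rewrite mul_mx_diag mxE; apply: eq_bigr => j _; rewrite !mxE; ring.
Qed.

Lemma dotv_orthogonal n (P : 'M[R]_n) x : P *m P^T = 1%:M ->
  dotv x x = \sum_j (x *m P^T) 0 j ^+ 2.
Proof.
move=> PP; rewrite -dotvE -{1}[x]mulmx1 -(mulmx1C PP) !mulmxA.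
rewrite -(mulmxA _ P).
have -> : P *m x^T = (x *m P^T)^T by rewrite trmx_mul trmxK.
by rewrite mxE; apply: eq_bigr => j _; rewrite [X in _ * X]mxE expr2.
Qed.

(** Courant-Fischer in one step: the span of the first [i + 1] eigenvectors of
[M] meets the span of the last [n - i] eigenvectors of [N], and on a common
nonzero vector the two quadratic forms compare [lambda N i] with [lambda M i]. *)
Lemma weyl_le n (M N : 'M[R]_n) c : M^T = M -> N^T = N ->
  (forall x, qform N x <= qform M x + c * dotv x x) ->
  forall i, lambda N i <= lambda M i + c.
Proof.
move=> /spectral_theorem [P [d [PP -> dh]]] /spectral_theorem [Q [e [QQ -> eh]]].
move=> le_form i; rewrite !lambda_orthogonal //.
(* [y K = 0] says that the coordinates of [y] after [i] vanish and that the
   coordinates before [i] of [y P Q^T] vanish; the zero column [i] makes this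
   system singular. *)
pose K := \matrix_(k, j) if (j < i)%N then (P *m Q^T) k j
                         else if j == i then 0 else ((k == j)%:R : R).
have /eqP/det0P [y y0 yK] : \det K = 0.
  rewrite (expand_det_col _ i) big1 // => k _.
  by rewrite mxE ltnn eqxx mul0r.
pose x := y *m P.
have xP : x *m P^T = y by rewrite /x -mulmxA PP mulmx1.
have y_hi (j : 'I_n) : (i < j)%N -> y 0 j = 0.
  move=> ij; move/rowP: yK => /(_ j); rewrite !mxE (bigD1 j) //= big1.
    by rewrite mxE ltnNge ltnW //= gt_eqF // eqxx mulr1 addr0.
  by move=> k kj; rewrite mxE ltnNge ltnW //= gt_eqF // (negPf kj) mulr0.
have x_lo (j : 'I_n) : (j < i)%N -> (x *m Q^T) 0 j = 0.
  move=> ji; move/rowP: yK => /(_ j); rewrite /x -mulmxA.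
  rewrite ![in X in X -> _]mxE => E; rewrite mxE -[RHS]E; apply: eq_bigr => k _.
  by rewrite [in RHS]mxE ji.
have x0 : 0 < dotv x x.
  rewrite lt_neqAle dotv_ge0 andbT eq_sym dotv_eq0; apply: contra y0 => /eqP x0.
  by rewrite -xP x0 mul0mx.
rewrite -(ler_pM2r x0) mulrDl; apply: le_trans (le_trans (le_form x) _).
  rewrite qform_orthogonal (dotv_orthogonal x QQ) mulr_sumr; apply: ler_sum => j _.
  case: (ltnP j i) => [/x_lo ->|ij]; first by rewrite expr0n !mulr0.
  by rewrite ler_wpM2r ?sqr_ge0 // eh.
rewrite lerD2r qform_orthogonal (dotv_orthogonal x PP) mulr_sumr xP.
apply: ler_sum => j _; case: (ltnP i j) => [/y_hi ->|ij].
  by rewrite expr0n !mulr0.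
by rewrite ler_wpM2r ?sqr_ge0 // dh.
Qed.

Lemma weyl n (M N : 'M[R]_n) c : M^T = M -> N^T = N ->
  (forall x, `|qform (N - M) x| <= c * dotv x x) ->
  forall i, `|lambda N i - lambda M i| <= c.
Proof.
move=> sM sN h i.
have qB x : qform (N - M) x = qform N x - qform M x.
  by rewrite /qform mulmxBr mulmxBl !mxE.
rewrite ler_norml; apply/andP; split.
  rewrite lerNl opprB lerBlDl; apply: weyl_le => // x.
  by have := h x; rewrite qB ler_norml => /andP [? _]; lra.
rewrite lerBlDl; apply: weyl_le => // x.
by have := h x; rewrite qB ler_norml => /andP [_ ?]; lra.
Qed.

Lemma expr_orthogonal n (P : 'M[R]_n) (d : 'rV[R]_n) m : P *m P^T = 1%:M ->
  (P^T *m diag_mx d *m P) ^+ m = P^T *m diag_mx (\row_i d 0 i ^+ m) *m P.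
Proof.
move=> PP; elim: m => [|m IH].
  rewrite expr0 (_ : \row_i _ = const_mx 1) ?diag_const_mx ?mulmx1 ?(mulmx1C PP)//.
  by apply/rowP => i; rewrite !mxE expr0.
rewrite exprS IH -[LHS]/(_ *m _) !mulmxA -(mulmxA _ P) PP mulmx1 -(mulmxA P^T).
congr (_ *m _ *m _); rewrite mulmx_diag; congr diag_mx; apply/rowP => i.
by rewrite !mxE exprS.
Qed.

Lemma mxtrace_orthogonal n (P : 'M[R]_n) (d : 'rV[R]_n) : P *m P^T = 1%:M ->
  \tr (P^T *m diag_mx d *m P) = \sum_i d 0 i.
Proof. by move=> PP; rewrite mxtrace_mulC mulmxA PP mul1mx mxtrace_diag. Qed.

(** Even powers make all eigenvalue contributions to the trace nonnegative, so
each single one is bounded by the trace. *)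
Lemma qform_le_trace n (M : 'M[R]_n) c s : M^T = M -> 0 <= c -> (0 < s)%N ->
  \tr (M ^+ s.*2) <= c ^+ s.*2 -> forall x, `|qform M x| <= c * dotv x x.
Proof.
move=> /spectral_theorem [P [d [PP -> _]]] c0 s0; rewrite expr_orthogonal //.
rewrite mxtrace_orthogonal // => le_tr x.
rewrite qform_orthogonal (dotv_orthogonal x PP) mulr_sumr.
apply: le_trans (ler_norm_sum _ _ _) _; apply: ler_sum => j _.
rewrite normrM (ger0_norm (sqr_ge0 _)) ler_wpM2r ?sqr_ge0 //.
rewrite -(@ler_pXn2r _ s.*2) ?nnegrE ?double_gt0 //; apply: le_trans le_tr.
rewrite -normrX (bigD1 j) //= mxE ger0_norm; last first.
  by rewrite -mul2n exprM exprn_ge0 ?sqr_ge0.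
rewrite lerDl sumr_ge0 // => i _; rewrite mxE -mul2n exprM.
by rewrite exprn_ge0 ?sqr_ge0.
Qed.

(** The squared Frobenius norm is the sum of the squared eigenvalues; each is at
most 1, and at most [\rank M] of them are nonzero. *)
Lemma frobenius_le_rank n (M : 'M[R]_n) : M^T = M ->
  (forall x, `|qform M x| <= dotv x x) ->
  \sum_i \sum_j M i j ^+ 2 <= (\rank M)%:R.
Proof.
move=> sM le_form.
have -> : \sum_i \sum_j M i j ^+ 2 = \tr (M ^+ 2).
  apply: eq_bigr => i _; rewrite expr2 -[_ * _]/(_ *m _) mxE.
  by apply: eq_bigr => j _; rewrite -{3}sM mxE expr2.
have [P [d [PP eM _]]] := spectral_theorem sM.
have d1 j : `|d 0 j| <= 1.
  have := le_form (row j P); rewrite eM qform_orthogonal (dotv_orthogonal _ PP).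
  rewrite -row_mul PP (bigD1 j) //= big1 => [|i ij]; last first.
    by rewrite !mxE eq_sym (negPf ij) expr0n mulr0.
  rewrite (bigD1 j) //= big1 => [|i ij]; last first.
    by rewrite !mxE eq_sym (negPf ij) expr0n.
  by rewrite !mxE eqxx expr1n mulr1 !addr0.
rewrite eM expr_orthogonal // mxtrace_orthogonal //.
apply: (@le_trans _ _ (#|[pred j | d 0 j != 0]|%:R)).
  rewrite -sum1_card natr_sum [leRHS]big_mkcond /=; apply: ler_sum => j _; rewrite mxE inE.
  have [->|_] := eqVneq (d 0 j) 0; first by rewrite expr0n.
  by rewrite -real_normK ?num_real // expr_le1.
rewrite ler_nat; set m := #|_|.
(* The eigenvectors with nonzero eigenvalues embed an identity matrix of that
   size into M, up to left and right multiplication. *)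
pose S := \matrix_(i < m, j < n) ((enum_val i == j)%:R : R).
pose C := \matrix_(j < n, i < m) ((enum_val i == j)%:R / d 0 j : R).
have SDC : S *m (P *m (P^T *m diag_mx d *m P) *m P^T) *m C = 1%:M.
  rewrite !mulmxA -(mulmxA S P) PP mulmx1 -(mulmxA _ P) PP mulmx1 mul_mx_diag.
  apply/matrixP => i i'; rewrite !mxE (bigD1 (enum_val i)) //= big1.
    rewrite !mxE eqxx mul1r addr0 eq_sym (inj_eq enum_val_inj).
    have := enum_valP i; rewrite inE => d0.
    by case: eqVneq => _; rewrite ?mul0r ?mulr0 // mul1r divff.
  by move=> j /negPf ji; rewrite !mxE eq_sym ji !mul0r.
rewrite -{1}(mxrank1 R m) -SDC.
apply: leq_trans (mxrankM_maxl _ _) _; apply: leq_trans (mxrankM_maxr _ _) _.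
by apply: leq_trans (mxrankM_maxl _ _) _; apply: leq_trans (mxrankM_maxr _ _) _.
Qed.
End SpectralConsequences.

(** * Expectation over the random graph *)

Section GraphExpectation.
Context {R : realType}.

(** A loop or pair of vertices is represented by the ordered pair at which
[graph_weight] reads it. *)
Definition edge n (i j : 'I_n) : 'I_n * 'I_n :=
  if (i <= j)%N then (i, j) else (j, i).

Definition ordered n (e : 'I_n * 'I_n) : bool := (e.1 <= e.2)%N.

Lemma edgeC n (i j : 'I_n) : edge i j = edge j i.
Proof.
rewrite /edge; case: ltngtP => // ij.
by congr (_, _); apply: val_inj.
Qed.

Lemma ordered_edge n (i j : 'I_n) : ordered (edge i j).
Proof. by rewrite /ordered /edge; case: ifPn => //=; rewrite -ltnNge => /ltnW. Qed.

Lemma edge_ordered n (e : 'I_n * 'I_n) : ordered e -> edge e.1 e.2 = e.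
Proof. by rewrite /edge /ordered => ->; case: e. Qed.

Lemma edge_sym T n (f : 'I_n -> 'I_n -> T) i j : (forall i j, f i j = f j i) ->
  f (edge i j).1 (edge i j).2 = f i j.
Proof. by move=> fC; rewrite /edge; case: ifP. Qed.

Lemma edge_eqP n (i a j c : 'I_n) :
  reflect ((i = j /\ a = c) \/ (i = c /\ a = j)) (edge i a == edge j c).
Proof.
apply: (iffP eqP) => [|[[-> ->]|[-> ->]]] //; last exact: edgeC.
by rewrite /edge; do 2 case: ifP => _; case=> -> ->; auto.
Qed.

Definition gexp n (p : 'M[R]_n) (f : 'M[bool]_n -> R) : R :=
  \sum_(G : 'M[bool]_n | is_graph G) graph_weight p G * f G.

Lemma graph_symmetric n (G : 'M[bool]_n) : is_graph G -> forall i j, G i j = G j i.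
Proof. by move=> /eqP sG i j; rewrite -{1}sG mxE. Qed.

Section FixedMatrix.
Context {n : nat} {p : 'M[R]_n}.

(** Independence of the edges.  A symmetric matrix is determined by its entries
on ordered pairs, which turns the sum over graphs into a sum over boolean
functions on those pairs. *)
Lemma gexp_prod (f : 'I_n * 'I_n -> bool -> R) :
  gexp p (fun G => \prod_(e | ordered e) f e (G e.1 e.2)) =
  \prod_(e | ordered e) (p e.1 e.2 * f e true + (1 - p e.1 e.2) * f e false).
Proof.
pose g e b := (if b then p e.1 e.2 else 1 - p e.1 e.2) * f e b.
transitivity (\prod_(e : 'I_n * 'I_n | ordered e) \sum_(b : bool) g e b);
  last first.
  apply: eq_bigr => e _; rewrite (bigD1 true) //= (bigD1 false) //= big1 ?addr0 //.
  by case.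
rewrite (big_distr_big_dep false).
pose h (G : 'M[bool]_n) := [ffun e => ordered e && G e.1 e.2].
pose h' (F : {ffun 'I_n * 'I_n -> bool}) : 'M[bool]_n := \matrix_(i, j) F (edge i j).
rewrite (reindex_onto h h') => [|F /pfamilyP [/supportP F0 _]]; last first.
  apply/ffunP => e; rewrite ffunE mxE; case: (boolP (ordered e)) => [oe|/F0 //].
  by rewrite edge_ordered.
apply: eq_big => [G|G sG].
  rewrite /is_graph; apply/idP/andP => [/graph_symmetric sG|[_ /eqP <-]].
    split.
      apply/pfamilyP; split=> //; apply/supportP => e ne.
      by rewrite ffunE; case: (boolP (ordered e)) ne => [oe|//]; rewrite -topredE /= oe.
    by apply/eqP/matrixP => i j; rewrite mxE ffunE ordered_edge (edge_sym _ _ sG).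
  by apply/eqP/matrixP => i j; rewrite !mxE edgeC.
rewrite /graph_weight -big_split; apply: eq_bigr => e oe.
by rewrite ffunE [ordered e]oe.
Qed.

Lemma gexp_sum (I : Type) (r : seq I) (P : pred I) (f : I -> 'M[bool]_n -> R) :
  gexp p (fun G => \sum_(i <- r | P i) f i G) = \sum_(i <- r | P i) gexp p (f i).
Proof.
rewrite /gexp exchange_big; apply: eq_bigr => G _; exact: mulr_sumr.
Qed.

Lemma gexpD f g : gexp p (fun G => f G + g G) = gexp p f + gexp p g.
Proof. by rewrite /gexp -big_split; apply: eq_bigr => G _; rewrite mulrDr. Qed.

Lemma gexpZ a f : gexp p (fun G => a * f G) = a * gexp p f.
Proof. by rewrite /gexp mulr_sumr; apply: eq_bigr => G _; rewrite mulrCA. Qed.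

Lemma eq_gexp f g : (forall G, is_graph G -> f G = g G) -> gexp p f = gexp p g.
Proof. by move=> fg; apply: eq_bigr => G sG; rewrite fg. Qed.

Lemma gexp1 : gexp p (fun=> 1) = 1.
Proof.
transitivity (gexp p (fun G => \prod_(e : 'I_n * 'I_n | ordered e) (1 : R))).
  by apply: eq_gexp => G _; rewrite big1.
rewrite (gexp_prod (fun _ _ => 1)) big1 // => e _.
by rewrite !mulr1 addrC subrK.
Qed.

Lemma gexp_const a : gexp p (fun=> a) = a.
Proof.
by rewrite -[RHS]mulr1 -gexp1 -gexpZ; apply: eq_gexp => G _; rewrite mulr1.
Qed.

Lemma graph_probE E : graph_prob p E = gexp p (fun G => (E G)%:R).
Proof.
rewrite /graph_prob /gexp big_mkcondr; apply: eq_bigr => G _.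
by case: (E G); rewrite ?mulr1 ?mulr0.
Qed.

Lemma graph_probC E : graph_prob p E = 1 - graph_prob p (predC E).
Proof.
apply/eqP; rewrite eq_sym subr_eq -gexp1 !graph_probE -gexpD; apply/eqP/eq_gexp.
by move=> G _ /=; case: (E G); rewrite ?addr0 ?add0r.
Qed.

Hypothesis p01 : forall i j, 0 <= p i j <= 1.

Lemma graph_weight_ge0 G : 0 <= graph_weight p G.
Proof.
apply: prodr_ge0 => e _; have /andP [p0 p1] := p01 e.1 e.2.
by case: ifP; rewrite ?subr_ge0.
Qed.

Lemma le_gexp f g : (forall G, is_graph G -> f G <= g G) -> gexp p f <= gexp p g.
Proof.
by move=> fg; apply: ler_sum => G sG; rewrite ler_wpM2l ?graph_weight_ge0 ?fg.
Qed.

Lemma gexp_ge0 f : (forall G, is_graph G -> 0 <= f G) -> 0 <= gexp p f.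
Proof.
by move=> f0; rewrite -(gexp_const 0); apply: le_gexp.
Qed.

Lemma le_graph_prob (E F : pred 'M[bool]_n) :
  (forall G, is_graph G -> E G -> F G) -> graph_prob p E <= graph_prob p F.
Proof.
move=> EF; rewrite !graph_probE; apply: le_gexp => G /EF.
by case: (E G) => [->|] //; rewrite ler_nat.
Qed.

Lemma graph_prob_le1 E : graph_prob p E <= 1.
Proof.
rewrite graph_probE -[leRHS]gexp1; apply: le_gexp => G _.
by case: (E G); rewrite ?ler01.
Qed.

Lemma graph_prob_ge0 E : 0 <= graph_prob p E.
Proof. by rewrite graph_probE; apply: gexp_ge0 => G _; rewrite ler0n. Qed.

Lemma graph_probU E F :
  graph_prob p (fun G => E G || F G) <= graph_prob p E + graph_prob p F.
Proof.
rewrite !graph_probE -gexpD; apply: le_gexp => G _.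
by case: (E G); case: (F G); rewrite ?addr0 ?add0r // -natrD ler_nat.
Qed.

Lemma graph_prob_exists (I : finType) (E : I -> pred 'M[bool]_n) :
  graph_prob p (fun G => [exists i, E i G]) <= \sum_i graph_prob p (E i).
Proof.
under eq_bigr do rewrite graph_probE.
rewrite graph_probE -gexp_sum; apply: le_gexp => G _.
case: existsP => [[i Ei]|_]; last by rewrite sumr_ge0.
by rewrite (bigD1 i) //= Ei lerDl sumr_ge0.
Qed.

Lemma graph_markov (E : pred 'M[bool]_n) f :
  (forall G, is_graph G -> 0 <= f G) ->
  (forall G, is_graph G -> E G -> 1 <= f G) -> graph_prob p E <= gexp p f.
Proof.
move=> f0 f1; rewrite graph_probE; apply: le_gexp => G sG.
by case: (boolP (E G)) => [/f1->//|_]; rewrite f0.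
Qed.

End FixedMatrix.
End GraphExpectation.

(** * Walks and the norm of the noise *)

Section WalkBound.
Context {R : realType} {n : nat}.
Implicit Types (S : {set 'I_n * 'I_n}) (V : {set 'I_n}).

(** Below, [S] is the set of open edges of a walk: those which were introduced
together with a new vertex and have been traversed exactly once. *)
Definition open_degree S (x : 'I_n) : nat := #|[set y | edge x y \in S]|.

(** In an undisturbed depth-first exploration the open edges form the path from
the root to the current vertex [z], so that [z] has open degree at most 1 and any
other vertex at most 2.  The excess measures the deviation from this. *)
Definition excess S (z : 'I_n) : nat :=
  (\sum_x (open_degree S x - (x != z).+1))%N.

Lemma open_degreeD S (z y x : 'I_n) : edge z y \in S -> z != y ->
  open_degree S x = (open_degree (S :\ edge z y) x + ((x == z) || (x == y)))%N.
Proof.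
rewrite /open_degree => zyS zy.
have [->|xz] := eqVneq x z.
  rewrite (cardsD1 y) inE zyS addnC; congr (_ + _)%N.
  apply: eq_card => w; rewrite !inE; congr (~~ _ && _).
  apply/eqP/edge_eqP => [->|[[_ ->]|[<- <-]]] //; by left.
have [->|xy] := eqVneq x y.
  rewrite (cardsD1 z) inE edgeC zyS addnC; congr (_ + _)%N.
  apply: eq_card => w; rewrite !inE; congr (~~ _ && _).
  apply/eqP/edge_eqP => [->|[[-> ->]|[_ ->]]] //; by right.
rewrite addn0; apply: eq_card => w; rewrite !inE.
case: eqVneq => // /eqP/edge_eqP [[xz' _]|[xy' _]].
  by rewrite xz' eqxx in xz.
by rewrite xy' eqxx in xy.
Qed.

(** Closing an edge lowers the open degrees of both ends by one, while the smaller
allowance passes from [z] to [y].  At [y] the two effects cancel; at [z] the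
excess falls as soon as a second open edge was there. *)
Lemma excess_close S (z y : 'I_n) : edge z y \in S -> z != y ->
  (excess (S :\ edge z y) y + (1 < open_degree S z) <= excess S z)%N.
Proof.
move=> zyS zy; rewrite /excess (bigD1 z) //= [leqRHS](bigD1 z) //= addnAC.
have dz := open_degreeD z zyS zy; rewrite eqxx /= in dz.
rewrite leq_add //; first by rewrite dz (negPf zy) eqxx /=; lia.
apply: leq_sum => x xz; rewrite (open_degreeD x zyS zy) (negPf xz) /=.
by case: (x == y) => /=; lia.
Qed.

Lemma excess_open S (z y : 'I_n) : edge z y \notin S -> z != y ->
  open_degree S y = 0%N -> (excess (edge z y |: S) y <= excess S z)%N.
Proof.
move=> zyS zy dy; apply: leq_sum => x _.
rewrite (@open_degreeD (edge z y |: S) z y x) ?setU11 // setU1K //.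
have [->|xz] := eqVneq x z; first by rewrite (negPf zy) /=; lia.
by have [->|xy] := eqVneq x y; rewrite ?dy /=; lia.
Qed.

Lemma excess_move S (z y : 'I_n) : (excess S y <= (excess S z).+1)%N.
Proof.
apply: (@leq_trans (\sum_x ((open_degree S x - (x != z).+1) + (x == y)))%N).
  by apply: leq_sum => x _; case: (x == z); case: (x == y) => /=; lia.
by rewrite big_split /= -[leqRHS]addn1 leq_add // (bigD1 y) //= eqxx big1 // => x /negPf ->.
Qed.

Variables (p c : 'M[R]_n) (K : R).
Hypothesis p_sym : forall i j, p i j = p j i.
Hypothesis p01 : forall i j, 0 <= p i j <= 1.
Hypothesis c_sym : forall i j, c i j = c j i.
Hypothesis cK : forall i j, 0 <= c i j <= K.

(** The centered adjacency matrix with entries rescaled by [c]. *)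
Definition noise (G : 'M[bool]_n) : 'M[R]_n :=
  \matrix_(i, j) (c i j * ((G i j)%:R - p i j)).

Definition noise_var (i j : 'I_n) : R := c i j ^+ 2 * (p i j * (1 - p i j)).

Implicit Types (M : 'I_n * 'I_n -> nat).

(** [M e] is the number of times that a walk has traversed [e]. *)
Definition monomial M (G : 'M[bool]_n) : R :=
  \prod_(e | ordered e) noise G e.1 e.2 ^+ M e.

Definition traverse M (e0 : 'I_n * 'I_n) : 'I_n * 'I_n -> nat :=
  fun e => (M e + (e == e0))%N.

Definition noise_moment (e : 'I_n * 'I_n) (m : nat) : R :=
  p e.1 e.2 * (c e.1 e.2 * (1 - p e.1 e.2)) ^+ m +
  (1 - p e.1 e.2) * (c e.1 e.2 * - p e.1 e.2) ^+ m.

Lemma noise_sym G : is_graph G -> forall i j, noise G i j = noise G j i.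
Proof.
by move=> sG i j; rewrite !mxE c_sym p_sym (graph_symmetric sG).
Qed.

Lemma noise_var_sym i j : noise_var i j = noise_var j i.
Proof. by rewrite /noise_var c_sym p_sym. Qed.

Lemma noise_var_ge0 i j : 0 <= noise_var i j.
Proof.
have /andP [p0 p1] := p01 i j.
by apply: mulr_ge0; rewrite ?sqr_ge0 ?mulr_ge0 ?subr_ge0.
Qed.

Lemma gexp_monomial M :
  gexp p (monomial M) = \prod_(e | ordered e) noise_moment e (M e).
Proof.
pose f (e : 'I_n * 'I_n) (b : bool) := (c e.1 e.2 * (b%:R - p e.1 e.2)) ^+ M e.
transitivity (gexp p (fun G => \prod_(e | ordered e) f e (G e.1 e.2))).
  by apply: eq_gexp => G _; apply: eq_bigr => e _; rewrite mxE.
by rewrite gexp_prod; apply: eq_bigr => e _; rewrite /f /noise_moment sub0r.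
Qed.

Lemma monomial_traverse M G i j : is_graph G ->
  monomial (traverse M (edge i j)) G = monomial M G * noise G i j.
Proof.
move=> sG; rewrite /monomial (bigD1 (edge i j)) ?ordered_edge //=.
rewrite [in RHS](bigD1 (edge i j)) ?ordered_edge //= mulrAC.
rewrite (edge_sym _ _ (noise_sym sG)) /traverse eqxx addn1 exprSr; congr (_ * _).
by apply: eq_bigr => e /andP [_ /negPf ->]; rewrite addn0.
Qed.

Lemma noise_moment1 e : noise_moment e 1 = 0.
Proof. by rewrite /noise_moment !expr1; ring. Qed.

Lemma noise_moment2 e : noise_moment e 2 = noise_var e.1 e.2.
Proof. by rewrite /noise_moment /noise_var; ring. Qed.

Lemma noise_moment_le e m : `|noise_moment e m.+2| <= noise_var e.1 e.2 * K ^+ m.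
Proof.
rewrite /noise_moment /noise_var.
have /andP [p0 p1] := p01 e.1 e.2; have /andP [c0 cK'] := cK e.1 e.2.
move: (p _ _) p0 p1 (c _ _) c0 cK' => q q0 q1 a a0 aK.
have q1' : 0 <= 1 - q by rewrite subr_ge0.
apply: le_trans (ler_normD _ _) _; rewrite [`|q * _|]normrM [`|(1 - q) * _|]normrM !normrX !normrM normrN.
rewrite !ger0_norm // !exprMn.
have -> : q * (a ^+ m.+2 * (1 - q) ^+ m.+2) + (1 - q) * (a ^+ m.+2 * q ^+ m.+2)
  = a ^+ 2 * (q * (1 - q)) * (a ^+ m * ((1 - q) ^+ m.+1 + q ^+ m.+1)).
  by rewrite !exprS; ring.
rewrite ler_wpM2l ?mulr_ge0 ?exprn_ge0 //.
apply: (@le_trans _ _ (a ^+ m * 1)); last by rewrite mulr1 lerXn2r // nnegrE // (le_trans a0).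
rewrite ler_wpM2l ?exprn_ge0 // !exprS.
apply: (@le_trans _ _ ((1 - q) * 1 + q * 1)); last by rewrite !mulr1 subrK.
by rewrite lerD // ler_wpM2l // exprn_ile1 // lerBlDr lerDl.
Qed.

(** An upper bound for the expected contribution of an edge, shaped so that each
traversal multiplies it by the cost of the step.  An edge traversed once has
mean zero; its entry anticipates a second traversal, by its variance when the
edge is open and by [K] otherwise, in agreement with [noise_var_le]. *)
Definition edge_cost S M e : R :=
  if e \in S then noise_var e.1 e.2 else
  match M e with 0%N => 1 | 1%N => K | m.+2 => noise_var e.1 e.2 * K ^+ m end.

Definition cost S M : R := \prod_(e | ordered e) edge_cost S M e.

(** The state of a walk that now stands at [z], with [V] the vertices visited so
far. *)
Record walk_state M S V (z : 'I_n) : Prop := WalkState {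
  current_visited : z \in V;
  ends_visited : forall e, (0 < M e)%N -> (e.1 \in V) && (e.2 \in V);
  open_once : forall e, e \in S -> M e = 1%N /\ e.1 != e.2 }.

Lemma noise_bound_ge0 (z : 'I_n) : 0 <= K.
Proof. by have /andP [c0 cK'] := cK z z; exact: le_trans cK'. Qed.

Lemma edge_cost_ge0 S M e : 0 <= edge_cost S M e.
Proof.
have K0 := noise_bound_ge0 e.1; rewrite /edge_cost; case: ifP => _; first exact: noise_var_ge0.
by case: (M e) => [|[|m]] //; rewrite mulr_ge0 ?noise_var_ge0 ?exprn_ge0.
Qed.

Lemma cost_ge0 S M : 0 <= cost S M.
Proof. by apply: prodr_ge0 => e _; apply: edge_cost_ge0. Qed.

Lemma gexp_monomial_le M S V z : walk_state M S V z ->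
  gexp p (monomial M) <= cost S M.
Proof.
move=> [_ _ once]; rewrite gexp_monomial; apply: le_trans (ler_norm _) _.
rewrite normr_prod; apply: ler_prod => e _; rewrite normr_ge0 /=.
rewrite /edge_cost; case: ifP => [/once [-> _]|_].
  by rewrite noise_moment1 normr0 noise_var_ge0.
case: (M e) => [|[|m]]; last exact: noise_moment_le.
  by rewrite /noise_moment !expr0 !mulr1 addrC subrK normr1.
by rewrite noise_moment1 normr0 (noise_bound_ge0 e.1).
Qed.

Lemma cost_traverse M S S' e0 w : ordered e0 -> 0 <= w ->
  edge_cost S' (traverse M e0) e0 <= w * edge_cost S M e0 ->
  (forall e, e != e0 -> (e \in S') = (e \in S)) ->
  cost S' (traverse M e0) <= w * cost S M.
Proof.
move=> oe0 w0 le0 eqS; rewrite /cost (bigD1 e0) // [in leRHS](bigD1 e0) //= mulrA.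
have -> : \prod_(e | ordered e && (e != e0)) edge_cost S' (traverse M e0) e =
          \prod_(e | ordered e && (e != e0)) edge_cost S M e.
  apply: eq_bigr => e /andP [_ ne]; rewrite /edge_cost eqS // /traverse.
  by rewrite (negPf ne) addn0.
by rewrite ler_wpM2r // prodr_ge0 // => e _; apply: edge_cost_ge0.
Qed.

Lemma noise_var_le i j : noise_var i j <= K ^+ 2.
Proof.
have /andP [c0 cK'] := cK i j; have /andP [p0 p1] := p01 i j.
rewrite -[leRHS]mulr1; apply: ler_pM; rewrite ?exprn_ge0 ?mulr_ge0 ?subr_ge0 //.
  by rewrite lerXn2r // nnegrE // (noise_bound_ge0 i).
by rewrite mulr_ile1 ?subr_ge0 // lerBlDr lerDl.
Qed.

Hypothesis row_var : forall i, \sum_j noise_var i j <= 1.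

(** The three summands are the contributions of opening steps, closing steps, and
all other steps. *)
Definition growth (B : nat) : R := 2 + B%:R ^+ 2 * K.

Lemma edge_ends V i j :
  ((edge i j).1 \in V) && ((edge i j).2 \in V) = (i \in V) && (j \in V).
Proof. by rewrite /edge; case: ifP => _ //=; rewrite andbC. Qed.

Lemma walk_state_step M S S' V V' z y : walk_state M S V z ->
  y \in V' -> {subset V <= V'} ->
  (forall e, e != edge z y -> (e \in S') = (e \in S)) ->
  (edge z y \in S' -> M (edge z y) = 0%N /\ z != y) ->
  walk_state (traverse M (edge z y)) S' V' y.
Proof.
move=> [zV ends once] yV' VV' eqS new; split=> // e; rewrite /traverse.
  have [->|_] := eqVneq; first by rewrite edge_ends (VV' _ zV) yV'.
  by rewrite addn0 => /ends /andP [/VV' -> /VV' ->].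
have [->|ne] := eqVneq e (edge z y); last by rewrite eqS // addn0 => /once.
move=> /new [-> zy]; split=> //; rewrite /edge; case: ifP => _ //=.
by rewrite eq_sym.
Qed.

Lemma expected_step M z x m :
  gexp p (fun G => monomial M G * (noise G ^+ m.+1) z x) =
  \sum_y gexp p (fun G => monomial (traverse M (edge z y)) G * (noise G ^+ m) y x).
Proof.
rewrite -gexp_sum; apply: eq_gexp => G sG; rewrite exprS mxE mulr_sumr.
by apply: eq_bigr => y _; rewrite monomial_traverse // mulrA.
Qed.

Lemma open_degree_le M S V z : walk_state M S V z -> (open_degree S z <= #|V|)%N.
Proof.
move=> st; rewrite /open_degree; apply/subset_leq_card/fintype.subsetP => y; rewrite inE => zyS.
have [e1 _] := open_once st zyS.
have := ends_visited st (e := edge z y); rewrite e1 edge_ends => /(_ isT).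
by case/andP.
Qed.

(** All closing steps together contribute at most as much as one step with
unchanged excess: with one open edge at [z] there is no choice, and with several
the at most [B] choices are paid for by the unit of excess that is lost. *)
Lemma sum_close_le M S V z (B : nat) : walk_state M S V z -> (#|V| <= B)%N ->
  \sum_(y | edge z y \in S) B%:R ^+ excess (S :\ edge z y) y <=
  B%:R ^+ excess S z :> R.
Proof.
move=> st VB; have dV := open_degree_le st.
have V0 : (0 < #|V|)%N by apply/card_gt0P; exists z; exact: current_visited st.
have B1 : 1 <= B%:R :> R by rewrite ler1n (leq_trans V0).
have close y : edge z y \in S ->
    (excess (S :\ edge z y) y + (1 < open_degree S z) <= excess S z)%N.
  move=> zyS; apply: excess_close => //; have [_] := open_once st zyS.
  by rewrite /edge; case: ifP => _ //=; rewrite eq_sym.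
have [d1|d1] := ltnP 1%N (open_degree S z); last first.
  apply: (@le_trans _ _ (\sum_(y | edge z y \in S) B%:R ^+ excess S z)).
    apply: ler_sum => y /close h; rewrite ler_weXn2l //.
    by apply: leq_trans h; rewrite leq_addr.
  rewrite sumr_const -[leLHS]mulr_natl ler_piMl ?exprn_ge0 // lern1.
  by move: d1; rewrite /open_degree cardsE.
apply: (@le_trans _ _ (\sum_(y | edge z y \in S) B%:R ^+ (excess S z).-1)).
  apply: ler_sum => y /close h; rewrite ler_weXn2l //.
  by move: h; rewrite d1 addn1 => h; rewrite -ltnS (ltn_predK h).
case: (posnP (excess S z)) => [e0|e0].
  rewrite big1 ?e0 // => y /close; rewrite d1 e0 addn1 //.
rewrite sumr_const -[in leRHS](prednK e0) exprS -[leLHS]mulr_natl ler_wpM2r ?exprn_ge0 //.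
rewrite ler_nat; apply: leq_trans VB; apply: leq_trans dV.
by rewrite /open_degree cardsE.
Qed.

(** Each step multiplies the bound by [growth B].  Opening steps contribute at
most 1 by the bound on the row variances, closing steps at most 1 by
[sum_close_le], and any other step leads to one of at most [B] visited vertices,
costs [K] and raises the excess by at most one, that is, contributes another
factor [B]. *)
Lemma walk_bound m : forall M S V z x B, walk_state M S V z -> (#|V| + m <= B)%N ->
  gexp p (fun G => monomial M G * (noise G ^+ m) z x) <=
  cost S M * growth B ^+ m * B%:R ^+ excess S z.
Proof.
elim: m => [|m IH] M S V z x B st VB.
  have B1 : (0 < B)%N.
    rewrite addn0 in VB; apply: leq_trans VB; apply/card_gt0P; exists z.
    exact: current_visited st.
  rewrite expr0 mulr1; apply: (@le_trans _ _ (cost S M)); last first.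
    by rewrite ler_peMr ?cost_ge0 // exprn_ege1 // ler1n.
  have -> : gexp p (fun G => monomial M G * (noise G ^+ 0) z x) =
            (z == x)%:R * gexp p (monomial M).
    by rewrite -gexpZ; apply: eq_gexp => G _; rewrite expr0 mxE mulrC.
  case: eqP => _; rewrite ?mul1r ?mul0r ?cost_ge0 //.
  exact: gexp_monomial_le st.
have zV := current_visited st.
have K0 := noise_bound_ge0 z.
have VB' : (#|V| + m <= B)%N by lia.
have B1 : 1 <= B%:R :> R.
  by rewrite ler1n; apply: leq_trans VB; rewrite addnS.
have L0 : 0 <= growth B ^+ m by rewrite exprn_ge0 // addr_ge0 // mulr_ge0.
set D := excess S z; set C := cost S M.
have C0 : 0 <= C by exact: cost_ge0.
have BD0 k : 0 <= B%:R ^+ k :> R by rewrite exprn_ge0.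
(* The share of the step from [z] to [y], by the kind of the step. *)
pose w y : R := if y \notin V then noise_var z y * B%:R ^+ D else
  if edge z y \in S then B%:R ^+ excess (S :\ edge z y) y else K * B%:R ^+ D.+1.
have combine a v u u' : 0 <= a -> 0 <= u -> a <= v * C -> u <= u' ->
    a * growth B ^+ m * u <= C * growth B ^+ m * (v * u').
  move=> a0 u0 av uu'; rewrite (_ : C * _ * _ = v * C * growth B ^+ m * u'); last by ring.
  by apply: ler_pM; rewrite ?mulr_ge0 // ler_wpM2r.
have step y : gexp p (fun G => monomial (traverse M (edge z y)) G * (noise G ^+ m) y x)
    <= C * growth B ^+ m * w y.
  have e0V := edge_sym z y noise_var_sym.
  rewrite /w; case: (boolP (y \in V)) => [yV|yV] /=; last first.
    have M0 : M (edge z y) = 0%N.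
      apply/eqP; rewrite -leqn0 leqNgt; apply: contra yV => /(ends_visited st).
      by rewrite edge_ends => /andP [].
    have zy : z != y by apply: contraNneq yV => <-.
    have zyS : edge z y \notin S.
      by apply/negP => /(open_once st) []; rewrite M0.
    have dy : open_degree S y = 0%N.
      apply/eqP; rewrite cards_eq0; apply/eqP/setP => v; rewrite !inE.
      apply: contraNF yV => /(open_once st) [e1 _].
      have := ends_visited st (e := edge y v); rewrite e1 edge_ends => /(_ isT).
      by case/andP.
    have st' : walk_state (traverse M (edge z y)) (edge z y |: S) (y |: V) y.
      apply: (walk_state_step st); rewrite ?setU11 //.
        by move=> v vV; rewrite inE vV orbT.
      by move=> e ne; rewrite !inE (negPf ne).
    apply: le_trans (IH _ _ _ _ x B st' _) _; first by rewrite cardsU1 yV; lia.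
    apply: combine; rewrite ?cost_ge0 ?BD0 //; last by rewrite ler_weXn2l // excess_open.
    apply: cost_traverse; rewrite ?ordered_edge ?noise_var_ge0 //.
      by rewrite /edge_cost setU11 (negPf zyS) M0 mulr1 e0V.
    by move=> e ne; rewrite !inE (negPf ne).
  case: (boolP (edge z y \in S)) => zyS.
    have [M1 ends_neq] := open_once st zyS.
    have zy : z != y.
      by move: ends_neq; rewrite /edge; case: ifP => _ //=; rewrite eq_sym.
    have eqS e : e != edge z y -> (e \in S :\ edge z y) = (e \in S).
      by move=> ne; rewrite !inE ne.
    have st' : walk_state (traverse M (edge z y)) (S :\ edge z y) V y.
      by apply: (walk_state_step st) => //; rewrite setD11.
    apply: le_trans (IH _ _ _ _ x B st' VB') _; rewrite -[X in _ <= _ * X]mul1r.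
    apply: combine; rewrite ?cost_ge0 ?BD0 //.
    apply: cost_traverse; rewrite ?ordered_edge //.
    by rewrite /edge_cost setD11 zyS /traverse M1 eqxx addn1 expr0 mulr1 mul1r.
  have st' : walk_state (traverse M (edge z y)) S V y.
    by apply: (walk_state_step st) => //; rewrite (negPf zyS).
  apply: le_trans (IH _ _ _ _ x B st' VB') _.
  apply: combine; rewrite ?cost_ge0 ?BD0 //; last by rewrite ler_weXn2l // excess_move.
  apply: cost_traverse; rewrite ?ordered_edge //.
  rewrite /edge_cost (negPf zyS) /traverse eqxx addn1.
  case: (M _) => [|[|k]]; first by rewrite mulr1.
    by rewrite expr0 mulr1 -expr2 noise_var_le.
  by rewrite mulrCA -exprS.
rewrite expected_step; apply: le_trans (ler_sum _ (fun y _ => step y)) _.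
rewrite -mulr_sumr exprSr -!mulrA ler_wpM2l // ler_wpM2l //.
pose c2 y : R := if edge z y \in S then B%:R ^+ excess (S :\ edge z y) y else 0.
pose c3 y : R := if y \in V then K * B%:R ^+ D.+1 else 0.
have w_le y : w y <= noise_var z y * B%:R ^+ D + c2 y + c3 y.
  have nv0 : 0 <= noise_var z y * B%:R ^+ D by rewrite mulr_ge0 ?noise_var_ge0.
  have c20 : 0 <= c2 y by rewrite /c2; case: ifP.
  have c30 : 0 <= c3 y by rewrite /c3; case: ifP => // _; rewrite mulr_ge0.
  rewrite /w; case: (boolP (y \in V)) => yV /=; last by rewrite -addrA lerDl addr_ge0.
  case: ifP => zyS.
    by rewrite {1}/c2 zyS -addrA addrCA lerDl addr_ge0.
  by rewrite {1}/c3 yV lerDr addr_ge0.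
apply: le_trans (ler_sum _ (fun y _ => w_le y)) _; rewrite !big_split /=.
have le1 : \sum_y noise_var z y * B%:R ^+ D <= B%:R ^+ D.
  by rewrite -mulr_suml ler_piMl.
have le2 : \sum_y c2 y <= B%:R ^+ D.
  rewrite -big_mkcond; apply: sum_close_le st _.
  by apply: leq_trans VB'; rewrite leq_addr.
have le3 : \sum_y c3 y <= B%:R ^+ 2 * K * B%:R ^+ D.
  rewrite -big_mkcond sumr_const -[leLHS]mulr_natl.
  have -> : B%:R ^+ 2 * K * B%:R ^+ D = B%:R * (K * B%:R ^+ D.+1) by rewrite [in RHS]exprS; ring.
  rewrite ler_wpM2r ?mulr_ge0 // ler_nat.
  by apply: leq_trans VB'; rewrite leq_addr.
rewrite /growth; lra.
Qed.

Lemma trace_bound m :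
  gexp p (fun G => \tr (noise G ^+ m)) <= n%:R * growth m.+1 ^+ m.
Proof.
rewrite /mxtrace gexp_sum -[n in leRHS]card_ord -sumr_const mulr_suml.
apply: ler_sum => z _.
have st : walk_state (fun=> 0%N) finset.set0 [set z]%SET z.
  by split; rewrite ?inE // => e; rewrite inE.
have := walk_bound (m := m) z (B := m.+1) st; rewrite cards1 add1n leqnn => /(_ isT).
rewrite /cost /edge_cost big1 => [|e _]; last by rewrite inE.
rewrite (_ : excess _ _ = 0%N) ?expr0 ?mulr1 => [h|]; last first.
  apply: big1 => x _; rewrite /open_degree (_ : [set y | _]%SET = finset.set0) ?cards0 //.
  by apply/setP => y; rewrite !inE.
apply: le_trans h; rewrite le_eqVlt; apply/orP/or_introl/eqP/eq_gexp => G _.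
by rewrite /monomial big1 ?mul1r // => e _; rewrite expr0.
Qed.
End WalkBound.

(** * Moments of the degree fluctuations *)

Section DegreeMoments.
Context {R : realType} {n : nat}.
Variable p : 'M[R]_n.
Hypothesis p_sym : forall i j, p i j = p j i.
Hypothesis p01 : forall i j, 0 <= p i j <= 1.

Let c : 'M[R]_n := const_mx 1.
Let c_sym i j : c i j = c j i. Proof. by rewrite !mxE. Qed.
Let c1 i j : 0 <= c i j <= 1. Proof. by rewrite mxE ler01 lexx. Qed.

Definition edge_var (i j : 'I_n) : R := p i j * (1 - p i j).

Let s (e : 'I_n * 'I_n) : R := edge_var e.1 e.2.

Let noise_varE i j : noise_var p c i j = edge_var i j.
Proof. by rewrite /noise_var mxE expr1n mul1r. Qed.

Lemma edge_var_sym i j : edge_var i j = edge_var j i.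
Proof. by rewrite /edge_var p_sym. Qed.

Lemma edge_var_ge0 i j : 0 <= edge_var i j.
Proof. by have /andP [? ?] := p01 i j; rewrite mulr_ge0 ?subr_ge0. Qed.

Lemma edge_var_le i j : edge_var i j <= p i j.
Proof. by have /andP [? ?] := p01 i j; rewrite ler_piMr // lerBlDr lerDl. Qed.

Let gexp_mon := gexp_monomial p c.

Lemma monomial0 G : monomial p c (fun=> 0%N) G = 1.
Proof. by apply: big1 => e _; exact: expr0. Qed.

Lemma gexp_monomial_single (M : 'I_n * 'I_n -> nat) e :
  ordered e -> M e = 1%N -> gexp p (monomial p c M) = 0.
Proof.
by move=> oe e1; rewrite gexp_mon (bigD1 e) //= e1 noise_moment1 mul0r.
Qed.

Lemma noise_moment0 e : noise_moment p c e 0 = 1.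
Proof. by rewrite /noise_moment !expr0 !mulr1 addrC subrK. Qed.

Lemma gexp_monomial_pairs (M : 'I_n * 'I_n -> nat) e f :
  ordered e -> ordered f -> f != e -> M e = 2%N -> M f = 2%N ->
  (forall g, g != e -> g != f -> M g = 0%N) ->
  gexp p (monomial p c M) = s e * s f.
Proof.
move=> oe of_ fe e2 f2 g0; rewrite gexp_mon (bigD1 e) //= (bigD1 f) /= ?of_ ?fe //.
rewrite big1 ?mulr1; last by move=> g /andP [/andP [_ ge] gf]; rewrite g0 // noise_moment0.
by rewrite e2 f2 !noise_moment2 !noise_varE.
Qed.

Lemma gexp_monomial_quadruple (M : 'I_n * 'I_n -> nat) e :
  ordered e -> M e = 4%N -> (forall g, g != e -> M g = 0%N) ->
  gexp p (monomial p c M) <= s e.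
Proof.
move=> oe e4 g0; rewrite gexp_mon (bigD1 e) //= big1 ?mulr1; last first.
  by move=> g /andP [_ ge]; rewrite g0 // noise_moment0.
have := noise_moment_le p01 c1 e 2; rewrite e4 expr1n mulr1 noise_varE.
exact/le_trans/ler_norm.
Qed.

(** Only products in which no edge occurs exactly once have nonzero mean: the
four edges are paired in one of three ways, or all coincide. *)
Lemma gexp_four_edges e1 e2 e3 e4 :
  ordered e1 -> ordered e2 -> ordered e3 -> ordered e4 ->
  gexp p (monomial p c (traverse (traverse (traverse (traverse (fun=> 0%N) e1) e2) e3) e4))
  <= ((e1 == e2) && (e3 == e4))%:R * (s e1 * s e3)
   + ((e1 == e3) && (e2 == e4))%:R * (s e1 * s e2)
   + ((e1 == e4) && (e2 == e3))%:R * (s e1 * s e2)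
   + [&& e1 == e2, e1 == e3 & e1 == e4]%:R * s e1.
Proof.
move=> o1 o2 o3 o4; set M := traverse _ _.
have ME e : M e = ((e == e1) + (e == e2) + (e == e3) + (e == e4))%N by [].
have s0 e : 0 <= s e by apply: edge_var_ge0.
have b0 (b : bool) x : 0 <= x -> 0 <= b%:R * x :> R by move=> ?; rewrite mulr_ge0.
set r := (X in _ <= X).
have r0 : 0 <= r by rewrite !(addr_ge0, s0, ler0n, mulr_ge0).
have single e : ordered e -> M e = 1%N -> gexp p (monomial p c M) <= r.
  by move=> oe e1'; rewrite (gexp_monomial_single oe e1').
have [e12|n12] := eqVneq e1 e2.
  have [e34|n34] := eqVneq e3 e4.
    have [e13|n13] := eqVneq e1 e3.
      have q : gexp p (monomial p c M) <= s e1.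
        apply: gexp_monomial_quadruple => //.
          by rewrite ME -e12 -e34 -e13 eqxx.
        by move=> g /negPf ge; rewrite ME -e12 -e34 -e13 ge.
      apply: le_trans q _; rewrite /r -e12 -e34 -e13 eqxx /= !mul1r lerDr.
      by rewrite !(addr_ge0, s0, ler0n, mulr_ge0).
    rewrite (@gexp_monomial_pairs M e1 e3) ?(eq_sym e3) //.
    + rewrite /r -e12 -e34 !eqxx /= mul1r -!addrA lerDl.
      by rewrite !(addr_ge0, s0, ler0n, mulr_ge0).
    + by rewrite ME -e12 -e34 eqxx (negPf n13).
    + by rewrite ME -e12 -e34 eqxx eq_sym (negPf n13).
    + by move=> g /negPf g1 /negPf g3; rewrite ME -e12 -e34 g1 g3.
  have [e13|n13] := eqVneq e1 e3.
    apply: (single e4) => //; rewrite ME -e12 e13 eqxx.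
    by rewrite eq_sym (negPf n34).
  apply: (single e3) => //; rewrite ME -e12 eqxx (negPf n34) eq_sym.
  by rewrite (negPf n13).
have [e13|n13] := eqVneq e1 e3.
  have [e24|n24] := eqVneq e2 e4.
    rewrite (@gexp_monomial_pairs M e1 e2) ?(eq_sym e2) //.
    + rewrite /r -e13 -e24 !eqxx /= (negPf n12) /= mul1r mul0r add0r -!addrA lerDl.
      by rewrite !(addr_ge0, s0, ler0n, mulr_ge0).
    + by rewrite ME -e13 -e24 eqxx (negPf n12).
    + by rewrite ME -e13 -e24 eqxx eq_sym (negPf n12).
    + by move=> g /negPf g1 /negPf g2; rewrite ME -e13 -e24 g1 g2.
  apply: (single e2) => //; rewrite ME -e13 eqxx (negPf n24) eq_sym.
  by rewrite (negPf n12).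
have [e14|n14] := eqVneq e1 e4.
  have [e23|n23] := eqVneq e2 e3.
    rewrite (@gexp_monomial_pairs M e1 e2) ?(eq_sym e2) //.
    + by rewrite /r -e14 -e23 !eqxx (negPf n12) /= !mul0r !add0r mul1r addr0.
    + by rewrite ME -e14 -e23 eqxx (negPf n12).
    + by rewrite ME -e14 -e23 eqxx eq_sym (negPf n12).
    + by move=> g /negPf g1 /negPf g2; rewrite ME -e14 -e23 g1 g2.
  apply: (single e2) => //; rewrite ME -e14 eqxx (negPf n23) eq_sym.
  by rewrite (negPf n12).
by apply: (single e1) => //; rewrite ME eqxx (negPf n12) (negPf n13) (negPf n14).
Qed.

Definition fluctuation (i : 'I_n) (G : 'M[bool]_n) : R :=
  degree (adjacency R G) i - degree p i.

Definition degree_var (i : 'I_n) : R := \sum_a edge_var i a.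

Lemma fluctuationE i G : fluctuation i G = \sum_a noise p c G i a.
Proof.
by rewrite /fluctuation /degree -sumrB; apply: eq_bigr => a _; rewrite !mxE mul1r.
Qed.

(** This is 1 when j is one of the ends of the edge {i, a}, and 0 otherwise. *)
Definition incident (j i a : 'I_n) : R := \sum_d (edge i a == edge j d)%:R.

Lemma incident_ge0 j i a : 0 <= incident j i a.
Proof. exact: sumr_ge0. Qed.

Lemma sum_pred1 (x : 'I_n) : \sum_d ((d == x)%:R : R) = 1.
Proof. by rewrite (bigD1 x) //= eqxx big1 ?addr0 // => d /negPf ->. Qed.

Lemma incident_le1 j i a : incident j i a <= 1.
Proof.
rewrite /incident; have [->|ji] := eqVneq j i.
  rewrite -[leRHS](sum_pred1 a); apply: ler_sum => d _.
  by case: edge_eqP => [[[_ ->]|[-> ->]]|]; rewrite ?eqxx ?ler0n.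
rewrite -[leRHS](sum_pred1 i); apply: ler_sum => d _.
case: edge_eqP => [[[ij _]|[-> _]]|]; rewrite ?eqxx ?ler0n //.
by rewrite ij eqxx in ji.
Qed.

Lemma sum_incident_le i a : \sum_j incident j i a <= 2.
Proof.
have <- : \sum_j ((j == i)%:R + (j == a)%:R) = 2 :> R.
  by rewrite big_split /= !sum_pred1.
apply: ler_sum => j _.
have [->|ji] := eqVneq j i.
  by apply: le_trans (incident_le1 _ _ _) _; rewrite /= mulr1n lerDl ler0n.
have [->|ja] := eqVneq j a.
  by apply: le_trans (incident_le1 _ _ _) _; rewrite /= mulr1n lerDr ler0n.
rewrite /= addr0 /incident big1 // => d _; case: edge_eqP => // -[[ij _]|[_ aj]].
  by rewrite ij eqxx in ji.
by rewrite aj eqxx in ja.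
Qed.

Lemma edge_injr (i a b : 'I_n) : (edge i a == edge i b) = (a == b).
Proof.
by apply/edge_eqP/eqP => [[[_ ->]|[-> ->]]|->] //; left.
Qed.

Lemma degree_var_ge0 i : 0 <= degree_var i.
Proof. by apply: sumr_ge0 => a _; apply: edge_var_ge0. Qed.

Lemma degree_var_le i : degree_var i <= degree p i.
Proof. by apply: ler_sum => a _; apply: edge_var_le. Qed.

(** Apart from the product of the variances, every term that survives in the
expansion into four edges needs an edge at [i] that is also an edge at [j]. *)
Lemma gexp_fluctuation2 i j :
  gexp p (fun G => fluctuation i G ^+ 2 * fluctuation j G ^+ 2) <=
  degree_var i * degree_var j +
  2 * (\sum_a edge_var i a * incident j i a) ^+ 2 +
  \sum_a edge_var i a * incident j i a.
Proof.
pose T a b d e := monomial p c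
  (traverse (traverse (traverse (traverse (fun=> 0%N) (edge i a)) (edge i b))
     (edge j d)) (edge j e)).
have -> : gexp p (fun G => fluctuation i G ^+ 2 * fluctuation j G ^+ 2) =
    \sum_a \sum_b \sum_d \sum_e gexp p (T a b d e).
  under [RHS]eq_bigr do under eq_bigr do under eq_bigr do rewrite -gexp_sum.
  under [RHS]eq_bigr do under eq_bigr do rewrite -gexp_sum.
  under [RHS]eq_bigr do rewrite -gexp_sum.
  rewrite -gexp_sum; apply: eq_gexp => G sG; rewrite !expr2 !fluctuationE.
  rewrite -mulrA mulr_suml; apply: eq_bigr => a _.
  rewrite mulrA [X in X * _]mulr_sumr mulr_suml; apply: eq_bigr => b _.
  rewrite mulrA [X in X * _]mulr_sumr mulr_suml; apply: eq_bigr => d _.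
  rewrite mulr_sumr; apply: eq_bigr => e _.
  rewrite /T !monomial_traverse // monomial0 mul1r ?mulrA //.
pose N a d : R := (edge i a == edge j d)%:R.
have T_le a b d e : gexp p (T a b d e) <=
   (a == b)%:R * (d == e)%:R * (edge_var i a * edge_var j d)
 + N a d * N b e * (edge_var i a * edge_var i b)
 + N a e * N b d * (edge_var i a * edge_var i b)
 + (a == b)%:R * (N a d * N a e) * edge_var i a.
  apply: le_trans (gexp_four_edges _ _ _ _) _; rewrite ?ordered_edge //.
  rewrite /s !(edge_sym _ _ edge_var_sym) !edge_injr /N -!mulnb !natrM.
  by rewrite !mulrA.
apply: le_trans (ler_sum _ (fun a _ => ler_sum _ (fun b _ => ler_sum _ (fun d _ =>
  ler_sum _ (fun e _ => T_le a b d e))))) _.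
set J := \sum_a edge_var i a * incident j i a.
under eq_bigr do under eq_bigr do under eq_bigr do rewrite !big_split.
under eq_bigr do under eq_bigr do rewrite !big_split.
under eq_bigr do rewrite !big_split.
rewrite !big_split /=.
have sum_pred1r (f : 'I_n -> R) x : \sum_y (x == y)%:R * f y = f x.
  rewrite (bigD1 x) //= eqxx mul1r big1 ?addr0 // => y.
  by rewrite eq_sym => /negPf ->; rewrite mul0r.
have e1 : \sum_a \sum_b \sum_d \sum_e
    (a == b)%:R * (d == e)%:R * (edge_var i a * edge_var j d) =
    degree_var i * degree_var j.
  rewrite mulr_suml; apply: eq_bigr => a _.
  under eq_bigr do under eq_bigr do under eq_bigr do rewrite -mulrA.
  under eq_bigr do under eq_bigr do rewrite -mulr_sumr sum_pred1r.
  by under eq_bigr do rewrite -mulr_sumr; rewrite sum_pred1r mulr_sumr.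
have e2 : \sum_a \sum_b \sum_d \sum_e N a d * N b e * (edge_var i a * edge_var i b)
  = J ^+ 2.
  rewrite expr2 mulr_suml; apply: eq_bigr => a _.
  rewrite mulr_sumr; apply: eq_bigr => b _.
  rewrite /incident [RHS]mulrACA [RHS]mulrC big_distrlr /= mulr_suml; apply: eq_bigr => d _.
  by rewrite mulr_suml.
have e3 : \sum_a \sum_b \sum_d \sum_e N a e * N b d * (edge_var i a * edge_var i b)
  = J ^+ 2.
  by rewrite -e2; do 2 (apply: eq_bigr => ? _); rewrite exchange_big.
have e4 : \sum_a \sum_b \sum_d \sum_e (a == b)%:R * (N a d * N a e) * edge_var i a
  <= J.
  apply: ler_sum => a _.
  have -> : \sum_b \sum_d \sum_e (a == b)%:R * (N a d * N a e) * edge_var i a =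
     edge_var i a * (incident j i a * incident j i a).
    rewrite -[RHS](sum_pred1r (fun=> edge_var i a * (incident j i a * incident j i a)) a); apply: eq_bigr => b _.
    rewrite /incident [X in _ * X]mulrC big_distrlr /= mulr_suml mulr_sumr.
    apply: eq_bigr => d _; rewrite mulr_suml mulr_sumr; apply: eq_bigr => e _.
    by rewrite /N; ring.
  rewrite ler_wpM2l ?edge_var_ge0 // ler_piMr ?incident_ge0 ?incident_le1 //.
rewrite e1 e2 e3; lra.
Qed.

Lemma incident_sum_ge0 i j : 0 <= \sum_a edge_var i a * incident j i a.
Proof. by apply: sumr_ge0 => a _; rewrite mulr_ge0 ?edge_var_ge0 ?incident_ge0. Qed.

Lemma incident_sum_le i j : \sum_a edge_var i a * incident j i a <= degree_var i.
Proof.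
by apply: ler_sum => a _; rewrite ler_piMr ?edge_var_ge0 ?incident_le1.
Qed.

Lemma gexp_fluctuation1 i : gexp p (fun G => fluctuation i G ^+ 2) = degree_var i.
Proof.
transitivity (\sum_a \sum_b gexp p (monomial p c
    (traverse (traverse (fun=> 0%N) (edge i a)) (edge i b)))).
  under [RHS]eq_bigr do rewrite -gexp_sum.
  rewrite -gexp_sum; apply: eq_gexp => G sG.
  rewrite expr2 fluctuationE big_distrlr; apply: eq_bigr => a _; apply: eq_bigr => b _.
  by rewrite !monomial_traverse // monomial0 mul1r.
apply: eq_bigr => a _; rewrite (bigD1 a) //= big1 ?addr0 => [|b ba].
  rewrite gexp_mon (bigD1 (edge i a)) ?ordered_edge //= big1 => [|e /andP [_ /negPf ne]].
    by rewrite /traverse eqxx noise_moment2 mulr1 noise_varE (edge_sym _ _ edge_var_sym).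
  by rewrite /traverse ne noise_moment0.
apply: (@gexp_monomial_single _ (edge i b)); first exact: ordered_edge.
by rewrite /traverse eqxx edge_injr (negPf ba).
Qed.

Lemma gexp_fluctuation4 i :
  gexp p (fun G => fluctuation i G ^+ 4) <= 3 * degree_var i ^+ 2 + degree_var i.
Proof.
have -> : gexp p (fun G => fluctuation i G ^+ 4) =
   gexp p (fun G => fluctuation i G ^+ 2 * fluctuation i G ^+ 2).
  by apply: eq_gexp => G _; rewrite -exprD.
apply: le_trans (gexp_fluctuation2 i i) _.
have h := incident_sum_le i i; have h0 := incident_sum_ge0 i i.
have : (\sum_a edge_var i a * incident i i a) ^+ 2 <= degree_var i ^+ 2.
  by rewrite lerXn2r // nnegrE // degree_var_ge0.
lra.
Qed.

(** An edge has only two ends, so the error terms of [gexp_fluctuation2] remain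
bounded when summed over [j]; the variance of the weighted sum is therefore of
the order of its largest weight times a sum over single vertices. *)
Lemma gexp_weighted_fluctuation2 (a : 'I_n -> R) A : (forall i, 0 <= a i <= A) ->
  gexp p (fun G => (\sum_i a i * fluctuation i G ^+ 2) ^+ 2) <=
  (\sum_i a i * degree_var i) ^+ 2 +
  A * \sum_i a i * (4 * degree_var i ^+ 2 + 2 * degree_var i).
Proof.
move=> aA.
have -> : gexp p (fun G => (\sum_i a i * fluctuation i G ^+ 2) ^+ 2) =
  \sum_i \sum_j a i * a j *
     gexp p (fun G => fluctuation i G ^+ 2 * fluctuation j G ^+ 2).
  under [RHS]eq_bigr do under eq_bigr do rewrite -gexpZ.
  under [RHS]eq_bigr do rewrite -gexp_sum.
  rewrite -gexp_sum; apply: eq_gexp => G _; rewrite expr2 big_distrlr /=.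
  by apply: eq_bigr => i _; apply: eq_bigr => j _; rewrite mulrACA.
rewrite expr2 big_distrlr /= mulr_sumr -big_split /=; apply: ler_sum => i _.
set v := degree_var i.
have v0 : 0 <= v by exact: degree_var_ge0.
have a0 j : 0 <= a j by case/andP: (aA j).
have aA' j : a j <= A by case/andP: (aA j).
have A0 : 0 <= A by exact: le_trans (a0 i) (aA' i).
pose J j := \sum_b edge_var i b * incident j i b.
have sJ : \sum_j J j <= 2 * v.
  rewrite exchange_big mulr_sumr; apply: ler_sum => b _.
  by rewrite -mulr_sumr mulrC ler_wpM2r ?edge_var_ge0 // sum_incident_le.
have term j : a i * a j * gexp p (fun G => fluctuation i G ^+ 2 * fluctuation j G ^+ 2)
    <= a i * v * (a j * degree_var j) + A * (a i * (2 * v + 1) * J j).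
  apply: le_trans (ler_wpM2l _ (gexp_fluctuation2 i j)) _; first by rewrite mulr_ge0.
  rewrite -/(J j) -/v -addrA mulrDr mulrACA lerD2l.
  have J0 : 0 <= J j by exact: incident_sum_ge0.
  have Jv : J j <= v by exact: incident_sum_le.
  have -> : a i * a j * (2 * J j ^+ 2 + J j) = a j * (a i * (2 * J j + 1) * J j) by ring.
  apply: ler_pM; rewrite ?mulr_ge0 ?addr_ge0 ?mulr_ge0 // ler_wpM2r // ler_wpM2l //.
  by rewrite lerD2r ler_wpM2l.
apply: le_trans (ler_sum _ (fun j _ => term j)) _; rewrite big_split /= lerD //.
rewrite -!mulr_sumr ler_wpM2l // -mulrA ler_wpM2l //.
apply: le_trans (ler_wpM2l _ sJ) _; first by rewrite addr_ge0 ?mulr_ge0.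
by rewrite le_eqVlt; apply/orP/or_introl/eqP; ring.
Qed.
End DegreeMoments.

(** * Uniform concentration of the degrees *)

Section Chernoff.
Context {R : realType} {n : nat}.
Variable p : 'M[R]_n.
Hypothesis p_sym : forall i j, p i j = p j i.
Hypothesis p01 : forall i j, 0 <= p i j <= 1.

(** From [expR (- x) >= 1 - x] one gets [expR x <= 1 / (1 - x)]. *)
Lemma expR_le_quadratic (x : R) : `|x| <= 2^-1 -> expR x <= 1 + x + 2 * x ^+ 2.
Proof.
rewrite ler_norml => /andP [x1 x2].
have h : 1 - x <= expR (- x) by exact: expR_ge1Dx.
have h0 : 0 < 1 - x by lra.
have e : expR x * expR (- x) = 1 by rewrite -expRD subrr expR0.
have e0 := expR_gt0 x.
have h1 : expR x * (1 - x) <= 1 by rewrite -[leRHS]e ler_wpM2l // ltW.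
rewrite -(ler_pM2r h0); apply: le_trans h1 _.
have -> : (1 + x + 2 * x ^+ 2) * (1 - x) = 1 + x ^+ 2 * (1 - 2 * x) by ring.
by rewrite lerDl mulr_ge0 ?sqr_ge0 // subr_ge0; lra.
Qed.

Lemma bernoulli_mgf (q x : R) : 0 <= q <= 1 -> `|x| <= 2^-1 ->
  q * expR (x * (1 - q)) + (1 - q) * expR (x * (0 - q)) <= expR (2 * x ^+ 2 * q).
Proof.
move=> /andP [q0 q1] x2.
have -> : q * expR (x * (1 - q)) + (1 - q) * expR (x * (0 - q)) =
          (1 + q * (expR x - 1)) * expR (- (x * q)).
  by rewrite mulrBr mulr1 expRD sub0r mulrN; ring.
apply: le_trans (ler_wpM2r (expR_ge0 _) (expR_ge1Dx _)) _.
rewrite -expRD ler_expR; have := ler_wpM2l q0 (expR_le_quadratic x2); lra.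
Qed.

(** [gexp_prod] needs one factor per edge, so the exponential is written as a
product over all edges, where an edge picks the factor of its end other than
[i]. *)
Lemma fluctuation_mgf i (x : R) : `|x| <= 2^-1 ->
  gexp p (fun G => expR (x * fluctuation p i G)) <= expR (2 * x ^+ 2 * degree p i).
Proof.
move=> x2.
pose f e (b : bool) := \prod_a (if e == edge i a then expR (x * (b%:R - p i a)) else 1).
have -> : gexp p (fun G => expR (x * fluctuation p i G)) =
    gexp p (fun G => \prod_(e | ordered e) f e (G e.1 e.2)).
  apply: eq_gexp => G sG; rewrite exchange_big fluctuationE mulr_sumr expR_sum.
  apply: eq_bigr => a _; rewrite (bigD1 (edge i a)) ?ordered_edge //= eqxx.
  rewrite big1 ?mulr1 => [|e /andP [_ /negPf ->]] //.
  by rewrite (edge_sym _ _ (graph_symmetric sG)) !mxE mul1r.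
rewrite gexp_prod.
have -> : expR (2 * x ^+ 2 * degree p i) = \prod_(e | ordered e)
    \prod_a (if e == edge i a then expR (2 * x ^+ 2 * p i a) else 1).
  rewrite exchange_big /degree mulr_sumr expR_sum; apply: eq_bigr => a _.
  rewrite (bigD1 (edge i a)) ?ordered_edge //= eqxx.
  by rewrite big1 ?mulr1 => [|e /andP [_ /negPf ->]].
apply: ler_prod => e _; have /andP [p0 p1] := p01 e.1 e.2.
have one (g : 'I_n -> R) a : \prod_b (if edge i a == edge i b then g b else 1) = g a.
  rewrite (bigD1 a) //= eqxx big1 ?mulr1 // => b ba.
  by rewrite edge_injr eq_sym (negPf ba).
have [/existsP [a /eqP ->]|] := boolP [exists a, e == edge i a].
  rewrite /f !(one (fun b => expR _)) (edge_sym _ _ p_sym) bernoulli_mgf // andbT.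
  by have /andP [? ?] := p01 i a; rewrite addr_ge0 ?mulr_ge0 ?expR_ge0 ?subr_ge0.
rewrite negb_exists => /forallP ne.
have one' (g : 'I_n -> R) : \prod_b (if e == edge i b then g b else 1) = 1.
  by rewrite big1 // => b _; rewrite (negPf (ne b)).
by rewrite /f !one' !mulr1 [_ + (1 - _)]addrC subrK ler01 lexx.
Qed.

Lemma degree_chernoff i (eta : R) : 0 < eta <= 2 ->
  graph_prob p (fun G => eta * degree p i < `|fluctuation p i G|) <=
  2 * expR (- (degree p i * eta ^+ 2 / 8)).
Proof.
move=> /andP [e0 e2]; set t := degree p i.
have x1 : `|eta / 4| <= 2^-1 by rewrite ger0_norm; lra.
have x2 : `|- (eta / 4)| <= 2^-1 by rewrite normrN.
(* The exponent [eta / 4] minimizes [2 x^2 t - x eta t]. *)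
pose F x G := expR (x * fluctuation p i G) * expR (- (eta / 4 * (eta * t))).
have Fle x : `|x| <= 2^-1 -> x ^+ 2 = (eta / 4) ^+ 2 ->
    gexp p (F x) <= expR (- (t * eta ^+ 2 / 8)).
  move=> hx x_eta; have -> : gexp p (F x) =
    expR (- (eta / 4 * (eta * t))) * gexp p (fun G => expR (x * fluctuation p i G)).
    by rewrite -gexpZ; apply: eq_gexp => G _; rewrite mulrC.
  apply: le_trans (ler_wpM2l (expR_ge0 _) (fluctuation_mgf i hx)) _.
  rewrite -expRD ler_expR x_eta -/t; lra.
apply: (@le_trans _ _ (gexp p (fun G => F (eta / 4) G + F (- (eta / 4)) G))); last first.
  by rewrite gexpD mulr2n mulrDl mul1r lerD // Fle // sqrrN.
apply: (graph_markov p01) => G _; first by rewrite addr_ge0 ?mulr_ge0 ?expR_ge0.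
rewrite lter_normr => /orP [] h.
  apply: le_trans (_ : F (eta / 4) G <= _); last by rewrite lerDl mulr_ge0 ?expR_ge0.
  rewrite /F -expRD -[leLHS]expR0 ler_expR -mulrBr mulr_ge0 //; lra.
apply: le_trans (_ : F (- (eta / 4)) G <= _); last by rewrite lerDr mulr_ge0 ?expR_ge0.
rewrite /F -expRD -[leLHS]expR0 ler_expR mulNr -mulrN -mulrBr mulr_ge0 //; lra.
Qed.
End Chernoff.

(** * Perturbation of the Laplacian *)

Section Perturbation.
Context {R : realType}.

(** Lagrange's identity. *)
Lemma cauchy_schwarz_sum (I : finType) (f g : I -> R) :
  (\sum_k f k * g k) ^+ 2 <= (\sum_k f k ^+ 2) * (\sum_k g k ^+ 2).
Proof.
have : 0 <= \sum_k \sum_l (f k * g l - f l * g k) ^+ 2.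
  by apply: sumr_ge0 => k _; apply: sumr_ge0 => l _; apply: sqr_ge0.
have -> : \sum_k \sum_l (f k * g l - f l * g k) ^+ 2 =
  2 * ((\sum_k f k ^+ 2) * (\sum_k g k ^+ 2)) - 2 * (\sum_k f k * g k) ^+ 2.
  pose A := \sum_k \sum_l f k ^+ 2 * g l ^+ 2.
  have eA : A = (\sum_k f k ^+ 2) * (\sum_k g k ^+ 2) by rewrite big_distrlr.
  have eA' : \sum_k \sum_l f l ^+ 2 * g k ^+ 2 = A by rewrite exchange_big.
  rewrite -eA expr2 big_distrlr /= mulr2n mulrDl mul1r -{2}eA'.
  rewrite mulr_sumr -!big_split -sumrB; apply: eq_bigr => k _.
  rewrite mulr_sumr -!big_split -sumrB; apply: eq_bigr => l _ /=.
  ring.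
lra.
Qed.

Lemma qformD n (A B : 'M[R]_n) x : qform (A + B) x = qform A x + qform B x.
Proof. by rewrite /qform mulmxDr mulmxDl mxE. Qed.

Lemma qformZ n c (A : 'M[R]_n) x : qform (c *: A) x = c * qform A x.
Proof. by rewrite /qform -scalemxAr -scalemxAl mxE. Qed.

Lemma frobenius_qform n (F : 'M[R]_n) b x : 0 <= b ->
  \sum_i \sum_j F i j ^+ 2 <= b ^+ 2 -> `|qform F x| <= b * dotv x x.
Proof.
move=> b0 Fb; have d0 := dotv_ge0 x.
rewrite -(@ler_pXn2r _ 2) ?nnegrE ?mulr_ge0 // real_normK ?num_real // exprMn.
apply: le_trans (ler_wpM2r (sqr_ge0 _) Fb).
rewrite qformE !pair_big /=.
have -> : dotv x x ^+ 2 = \sum_(k : 'I_n * 'I_n) (x 0 k.1 * x 0 k.2) ^+ 2.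
  rewrite expr2 /dotv big_distrlr /= pair_big; apply: eq_bigr => k _ /=; ring.
exact: cauchy_schwarz_sum.
Qed.

Definition normalized n (M : 'M[R]_n) : 'M[R]_n :=
  inv_sqrt_degrees M *m M *m inv_sqrt_degrees M.

Lemma normalizedE n (M : 'M[R]_n) i j : normalized M i j =
  M i j / (Num.sqrt (degree M i) * Num.sqrt (degree M j)).
Proof.
rewrite /normalized mul_mx_diag mxE mul_diag_mx !mxE invfM.
ring.
Qed.

Lemma laplacianB n (M N : 'M[R]_n) :
  laplacian M - laplacian N = normalized N - normalized M.
Proof. by rewrite /laplacian opprB addrC addrA subrK. Qed.

Section Weighted.
Variables (n : nat) (p : 'M[R]_n).
Hypothesis p_sym : forall i j, p i j = p j i.
Hypothesis p_ge0 : forall i j, 0 <= p i j.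
Hypothesis degree_gt0 : forall i, 0 < degree p i.

Lemma normalized_sym i j : (normalized p) i j = (normalized p) j i.
Proof. by rewrite !normalizedE p_sym [X in _ / X]mulrC. Qed.

Lemma sqrt_degree_gt0 i : 0 < Num.sqrt (degree p i).
Proof. by rewrite sqrtr_gt0. Qed.

(** By the inequality of arithmetic and geometric means each entry contributes at
most [p_ij (x_i^2 / t_i + x_j^2 / t_j) / 2], and the rows of [p] sum to [t]. *)
Lemma normalized_qform x : `|qform (normalized p) x| <= dotv x x.
Proof.
rewrite qformE; apply: le_trans (ler_norm_sum _ _ _) _.
pose y i := x 0 i ^+ 2 / degree p i.
have ysum : \sum_i \sum_j p i j * y i = dotv x x.
  apply: eq_bigr => i _; rewrite -mulr_suml /y mulrCA divff ?mulr1 ?expr2 //.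
  by rewrite gt_eqF ?degree_gt0.
have ysum' : \sum_i \sum_j p i j * y j = dotv x x.
  rewrite -ysum exchange_big; apply: eq_bigr => i _; apply: eq_bigr => j _.
  by rewrite p_sym.
have -> : dotv x x = \sum_i \sum_j p i j * (2^-1 * (y i + y j)).
  apply: (@mulfI _ 2); first by rewrite pnatr_eq0.
  rewrite mulr2n mulrDl mul1r -{1}ysum -ysum' -big_split mulr_sumr.
  apply: eq_bigr => i _; rewrite -big_split mulr_sumr; apply: eq_bigr => j _ /=.
  by field.
apply: ler_sum => i _; apply: le_trans (ler_norm_sum _ _ _) _.
apply: ler_sum => j _; rewrite normalizedE -mulrA normrM ger0_norm //.
have yE k : y k = (x 0 k / Num.sqrt (degree p k)) ^+ 2.
  by rewrite expr_div_n sqr_sqrtr // ltW ?degree_gt0.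
rewrite ler_wpM2l // !yE.
have := sqrt_degree_gt0 i; have := sqrt_degree_gt0 j.
move: (Num.sqrt (degree p i)) (Num.sqrt (degree p j)) => a b b0 a0.
have -> : (a * b)^-1 * (x 0 i * x 0 j) = (x 0 i / a) * (x 0 j / b).
  by field; rewrite !gt_eqF.
move: (_ / a) (_ / b) => u v.
rewrite ler_norml; apply/andP; split.
  by have := sqr_ge0 (u + v); nra.
by have := sqr_ge0 (u - v); nra.
Qed.

Definition row_weight i : R := \sum_j (normalized p) i j ^+ 2.

Lemma row_weight_ge0 i : 0 <= row_weight i.
Proof. by apply: sumr_ge0 => j _; apply: sqr_ge0. Qed.

Lemma sum_row_weight : \sum_i row_weight i <= (\rank p)%:R.
Proof.
apply: (@le_trans _ _ (\rank (normalized p))%:R).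
  apply: frobenius_le_rank; last exact: normalized_qform.
  by apply/matrixP => i j; rewrite mxE normalized_sym.
rewrite ler_nat; apply: leq_trans (mxrankM_maxl _ _) _; exact: mxrankM_maxr.
Qed.

Lemma row_weight_le delta : 0 < delta -> (forall i, delta <= degree p i) ->
  (forall i j, p i j <= 1) -> forall i, row_weight i <= delta^-1.
Proof.
move=> d0 dt p1 i.
have -> : delta^-1 = \sum_j p i j * (degree p i * delta)^-1.
  by rewrite -mulr_suml invfM mulrA divff ?mul1r // gt_eqF ?degree_gt0.
apply: ler_sum => j _; rewrite normalizedE expr_div_n exprMn !sqr_sqrtr ?(ltW (degree_gt0 _)) //.
apply: ler_pM; rewrite ?invr_ge0 ?mulr_ge0 ?(ltW (degree_gt0 _)) ?sqr_ge0 //.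
  by rewrite expr2 ler_piMr.
by rewrite lef_pV2 ?posrE ?mulr_gt0 ?degree_gt0 // ler_wpM2l // ltW ?degree_gt0.
Qed.

(** For [d = (1 + u) t] and [g = sqrt (d / t)], the ratio [sqrt (t / d)] is
[g^-1]; both remainders are explicit multiples of powers of [g - 1]. *)
Lemma sqrt_ratio_expansion (u g : R) : 0 < g -> g ^+ 2 = 1 + u -> `|u| <= 2^-1 ->
  `|g^-1 - 1| <= `|u| /\ `|g^-1 - 1 + u / 2| <= u ^+ 2.
Proof.
move=> g0 eg; rewrite ler_norml => /andP [u1 u2].
have gN0 : g != 0 by rewrite gt_eqF.
have g1 : 2 / 3 <= g.
  by rewrite leNgt; apply/negP => h; move: eg; rewrite expr2; nra.
have eu : u = (g - 1) * (g + 1) by rewrite -[LHS](addKr 1) -eg; ring.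
have -> : g^-1 - 1 = (1 - g) * g^-1 by field.
have -> : (1 - g) * g^-1 + u / 2 = (g - 1) ^+ 2 * ((g + 2) / (2 * g)).
  by rewrite eu; field.
have gi0 : 0 < g^-1 by rewrite invr_gt0.
split.
  have h1 : g^-1 <= g + 1 by rewrite -(ler_pM2r g0) mulVf //; nra.
  by rewrite eu !normrM distrC ler_wpM2l // (ger0_norm (ltW gi0)) ger0_norm //; lra.
rewrite eu exprMn normrM ger0_norm ?sqr_ge0 // ler_wpM2l ?sqr_ge0 //.
rewrite ger0_norm; last by rewrite divr_ge0; lra.
rewrite ler_pdivrMr; last lra.
nra.
Qed.

(** The difference is [- W1 + W2 + W3] with the noise [W1 = q C q], the first
order term [W2] with entries [N_ij (u_i + u_j) / 2] and a second order remainder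
[W3].  By symmetry of [N], [W2] has the same quadratic form as the matrix with
entries [N_ij u_i], which saves a factor 2 in its Frobenius norm; this is what
makes the coefficient of [sqrt k] equal to 1 in the end. *)
Lemma laplacian_perturbation (M : 'M[R]_n) (u : 'I_n -> R) (eta gamma y z : R) :
  0 <= eta <= 2^-1 -> 0 <= gamma -> 0 <= y -> 0 <= z ->
  (forall i, degree M i = degree p i * (1 + u i)) -> (forall i, `|u i| <= eta) ->
  (forall x, `|qform (\matrix_(i, j) ((M i j - p i j) /
      (Num.sqrt (degree p i) * Num.sqrt (degree p j)))) x| <= gamma * dotv x x) ->
  \sum_i row_weight i * u i ^+ 2 <= y ^+ 2 ->
  \sum_i row_weight i * u i ^+ 4 <= z ^+ 2 ->
  forall x, `|qform (laplacian M - laplacian p) x|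
    <= (gamma / (1 - eta) + y + 3 * z) * dotv x x.
Proof.
move=> /andP [eta0 eta1] gamma0 y0 z0 dM u_eta C_le Y_le Z_le x.
set C := \matrix_(_, _) _ in C_le.
pose st i := Num.sqrt (degree p i).
pose g i := Num.sqrt (1 + u i).
have st0 i : 0 < st i by rewrite sqrtr_gt0 degree_gt0.
have u1 i : 2^-1 <= 1 + u i.
  by have := u_eta i; rewrite ler_norml => /andP [? _]; lra.
have g0 i : 0 < g i by rewrite sqrtr_gt0; have := u1 i; lra.
have g2 i : g i ^+ 2 = 1 + u i by rewrite sqr_sqrtr //; have := u1 i; lra.
have dMs i : Num.sqrt (degree M i) = st i * g i.
  by rewrite dM sqrtrM // ltW ?degree_gt0.
have q_exp i := sqrt_ratio_expansion (g0 i) (g2 i) (le_trans (u_eta i) eta1).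
pose q i := (g i)^-1.
pose W1 := \matrix_(i, j) (q i * q j * C i j).
pose W2 := \matrix_(i, j) (normalized p i j * ((u i + u j) / 2)).
pose r i j := q i * q j - 1 + (u i + u j) / 2.
pose W3 := \matrix_(i, j) (- (normalized p i j * r i j)).
have -> : laplacian M - laplacian p = (-1) *: W1 + W2 + W3.
  rewrite laplacianB; apply/matrixP => i j.
  have -> : (normalized p - normalized M) i j = normalized p i j - normalized M i j.
    by rewrite !mxE.
  have -> : ((-1) *: W1 + W2 + W3) i j = - W1 i j + W2 i j + W3 i j.
    by rewrite !mxE mulN1r.
  rewrite [W1 i j]mxE [W2 i j]mxE [W3 i j]mxE [C i j]mxE.
  rewrite !normalizedE !dMs /r /q -/(st i) -/(st j).
  field.
  by rewrite !gt_eqF.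
have d0 := dotv_ge0 x.
rewrite !qformD qformZ mulN1r; apply: le_trans (ler_normD _ _) _.
rewrite 2!mulrDl; apply: lerD; first (apply: le_trans (ler_normD _ _) _; apply: lerD).
- rewrite normrN; pose x' : 'rV[R]_n := \row_i (q i * x 0 i).
  have -> : qform W1 x = qform C x'.
    rewrite !qformE; apply: eq_bigr => i _; apply: eq_bigr => j _.
    by rewrite ![W1 _ _]mxE ![x' _ _]mxE; ring.
  have gi0 : 0 <= (1 - eta)^-1 by rewrite invr_ge0; lra.
  have x'_le : dotv x' x' <= (1 - eta)^-1 * dotv x x.
    rewrite mulr_sumr; apply: ler_sum => i _; rewrite mxE -!expr2 exprMn.
    rewrite ler_wpM2r ?sqr_ge0 // /q exprVn g2 lef_pV2 ?posrE.
    + by have := u_eta i; rewrite ler_norml => /andP [? _]; lra.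
    + by have := u1 i; lra.
    + by lra.
  have d'0 := dotv_ge0 x'.
  apply: le_trans (C_le x') _; rewrite -mulrA ler_wpM2l //.
- have -> : qform W2 x = qform (\matrix_(i, j) (normalized p i j * u i)) x.
    rewrite !qformE.
    have e : \sum_i \sum_j normalized p i j * u j * (x 0 i * x 0 j) =
             \sum_i \sum_j normalized p i j * u i * (x 0 i * x 0 j).
      rewrite exchange_big; apply: eq_bigr => i _; apply: eq_bigr => j _.
      by rewrite normalized_sym [x 0 j * _]mulrC.
    apply: (@mulfI _ 2); first by rewrite pnatr_eq0.
    rewrite [in RHS]mulr2n [RHS]mulrDl mul1r.
    under [X in _ = X + _]eq_bigr do under eq_bigr do rewrite mxE.
    under [X in _ = _ + X]eq_bigr do under eq_bigr do rewrite mxE.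
    rewrite -{2}e -big_split mulr_sumr; apply: eq_bigr => i _.
    rewrite -big_split mulr_sumr; apply: eq_bigr => j _ /=.
    by rewrite mxE; field.
  apply: frobenius_qform => //; apply: le_trans Y_le; apply: ler_sum => i _.
  rewrite mulr_suml; apply: ler_sum => j _.
  by rewrite mxE exprMn.
apply: frobenius_qform; first by rewrite mulr_ge0.
pose Z i j := normalized p i j ^+ 2 * u i ^+ 4.
have eZ : \sum_i \sum_j Z i j = \sum_i row_weight i * u i ^+ 4.
  by apply: eq_bigr => i _; rewrite mulr_suml.
have eZ' : \sum_i \sum_j Z j i = \sum_i row_weight i * u i ^+ 4.
  by rewrite exchange_big.
apply: (@le_trans _ _ (\sum_i \sum_j (9 / 2) * (Z i j + Z j i))).
  apply: ler_sum => i _; apply: ler_sum => j _.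
  rewrite mxE sqrrN exprMn /Z [normalized p j i]normalized_sym -mulrDr.
  rewrite [leRHS]mulrCA ler_wpM2l ?sqr_ge0 //.
  have r_le : `|r i j| <= 3 / 2 * (u i ^+ 2 + u j ^+ 2).
    have -> : r i j = (q i - 1 + u i / 2) + (q j - 1 + u j / 2) + (q i - 1) * (q j - 1).
      by rewrite /r; field.
    have [a1 b1] := q_exp i; have [a2 b2] := q_exp j.
    apply: le_trans (ler_normD _ _) _.
    have := ler_normD (q i - 1 + u i / 2) (q j - 1 + u j / 2).
    have ab : `|(q i - 1) * (q j - 1)| <= `|u i| * `|u j| by rewrite normrM ler_pM.
    have := sqr_ge0 (`|u i| - `|u j|).
    have := real_normK (num_real (u i)); have := real_normK (num_real (u j)).
    move: b1 b2; rewrite -/(q i) -/(q j); nra.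
  have := real_normK (num_real (r i j)) => <-.
  have h : `|r i j| ^+ 2 <= (3 / 2 * (u i ^+ 2 + u j ^+ 2)) ^+ 2.
    by rewrite lerXn2r // nnegrE // mulr_ge0 // addr_ge0 ?sqr_ge0.
  apply: le_trans h _; have := sqr_ge0 (u i ^+ 2 - u j ^+ 2).
  rewrite -[4%N]/(2 * 2)%N !exprM; move: (u i ^+ 2) (u j ^+ 2) => a b; nra.
under eq_bigr do rewrite -mulr_sumr big_split.
rewrite -mulr_sumr big_split /= eZ eZ' exprMn; lra.
Qed.
End Weighted.
End Perturbation.

(** * Failure probability for a fixed number of vertices *)

Section FailureProbability.
Context {R : realType} {n : nat}.
Variable p : 'M[R]_n.
Hypothesis p_sym : forall i j, p i j = p j i.
Hypothesis p01 : forall i j, 0 <= p i j <= 1.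

Let p_ge0 i j : 0 <= p i j. Proof. by case/andP: (p01 i j). Qed.
Let p_le1 i j : p i j <= 1. Proof. by case/andP: (p01 i j). Qed.

Lemma trace_even_ge0 (M : 'M[R]_n) s : M^T = M -> 0 <= \tr (M ^+ s.*2).
Proof.
move=> /spectral_theorem [P [d [PP -> _]]].
rewrite expr_orthogonal // mxtrace_orthogonal // sumr_ge0 // => i _.
by rewrite mxE -mul2n exprM exprn_ge0 ?sqr_ge0.
Qed.

Lemma noise_norm_prob (c : 'M[R]_n) K beta s :
  (forall i j, c i j = c j i) -> (forall i j, 0 <= c i j <= K) ->
  (forall i, \sum_j noise_var p c i j <= 1) -> 0 < beta -> (0 < s)%N ->
  graph_prob p (fun G =>
    ~~ `[< forall x, `|qform (noise p c G) x| <= beta * dotv x x >]) <=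
  n%:R * (growth K s.*2.+1 / beta) ^+ s.*2.
Proof.
move=> c_sym cK row_var b0 s0.
have symH G : is_graph G -> (noise p c G)^T = noise p c G.
  by move=> sG; apply/matrixP => i j; rewrite mxE (noise_sym p_sym c_sym sG).
have bs0 : 0 < beta ^+ s.*2 by rewrite exprn_gt0.
apply: le_trans (_ : gexp p (fun G => (beta ^+ s.*2)^-1 *
    \tr (noise p c G ^+ s.*2)) <= _).
  apply: (graph_markov p01) => G sG.
    by rewrite mulr_ge0 ?invr_ge0 ?(ltW bs0) ?trace_even_ge0 ?symH.
  apply: contraR; rewrite -ltNge mulrC ltr_pdivrMr // mul1r => /ltW h.
  apply/asboolP; apply: (@qform_le_trace _ _ _ _ s) => //; [exact: symH|exact: ltW].
rewrite gexpZ expr_div_n mulrC mulrA ler_wpM2r ?invr_ge0 ?(ltW bs0) //.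
exact: trace_bound.
Qed.

Section LargeDegrees.
Variable delta : R.
Hypothesis delta1 : 1 <= delta.
Hypothesis delta_le : forall i, delta <= degree p i.

Let delta0 : 0 < delta. Proof. exact: lt_le_trans delta1. Qed.
Let degree_gt0 i : 0 < degree p i. Proof. exact: lt_le_trans (delta_le i). Qed.

Definition relative_fluctuation G i : R := fluctuation p i G / degree p i.

Let row_weight_le1 := row_weight_le p_ge0 degree_gt0 delta0 delta_le p_le1.

(** The weight of the squared absolute, not relative, fluctuation. *)
Let a i : R := row_weight p i / degree p i ^+ 2.

Let a_ge0 i : 0 <= a i.
Proof. by rewrite divr_ge0 ?row_weight_ge0 ?sqr_ge0. Qed.

Let a_le i : a i <= delta^-1 ^+ 3.
Proof.
rewrite /a [leRHS]exprS -exprVn ler_pM ?row_weight_ge0 ?exprn_ge0 ?invr_ge0 ?(ltW (degree_gt0 i)) //.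
rewrite lerXn2r ?nnegrE ?invr_ge0 ?(ltW delta0) ?(ltW (degree_gt0 i)) // lef_pV2 ?posrE ?delta0 ?degree_gt0 ?delta_le //.
Qed.

Let degree_ge1 i : 1 <= degree p i. Proof. exact: le_trans (delta_le i). Qed.

Lemma first_order_mean : \sum_i a i * degree_var p i <= (\rank p)%:R / delta.
Proof.
apply: le_trans (_ : (\sum_i row_weight p i) / delta <= _); last first.
  by rewrite ler_wpM2r ?invr_ge0 ?(ltW delta0) // sum_row_weight.
rewrite mulr_suml; apply: ler_sum => i _.
rewrite /a -mulrA ler_wpM2l ?row_weight_ge0 //.
apply: le_trans (_ : (degree p i)^-1 <= _); last by rewrite lef_pV2 ?posrE.
rewrite expr2 invfM -mulrA ler_piMr ?invr_ge0 ?(ltW (degree_gt0 i)) //.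
by rewrite mulrC ler_pdivrMr // mul1r degree_var_le.
Qed.

(** Chebyshev's inequality; a tolerance [tau] independent of the rank is enough
because the variance is smaller than the squared scale [delta^-2] by a factor
[rank / delta]. *)
Lemma first_order_prob tau : 0 < tau ->
  graph_prob p (fun G => ((\rank p)%:R + tau) / delta <
     \sum_i row_weight p i * relative_fluctuation G i ^+ 2) <=
  6 * (\rank p)%:R / (tau ^+ 2 * delta).
Proof.
move=> tau0; pose m := \sum_i a i * degree_var p i.
pose Y G := \sum_i a i * fluctuation p i G ^+ 2.
have YE G : \sum_i row_weight p i * relative_fluctuation G i ^+ 2 = Y G.
  apply: eq_bigr => i _; rewrite /relative_fluctuation /a expr_div_n; ring.
pose s := (delta / tau) ^+ 2.
have s0 : 0 <= s by rewrite sqr_ge0.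
have EY : gexp p Y = m.
  rewrite gexp_sum; apply: eq_bigr => i _.
  by rewrite gexpZ gexp_fluctuation1.
apply: le_trans (_ : gexp p (fun G => s * (Y G - m) ^+ 2) <= _).
  apply: (graph_markov p01) => G _; first by rewrite mulr_ge0 ?sqr_ge0.
  rewrite YE mulrDl => h; rewrite -exprMn -[leLHS](expr1n _ 2).
  have h' : tau / delta <= Y G - m by have := first_order_mean; rewrite -/m; lra.
  have one : 1 <= delta / tau * (Y G - m).
    apply: le_trans (_ : delta / tau * (tau / delta) <= _); last first.
      by rewrite ler_wpM2l // divr_ge0 // ltW.
    by rewrite le_eqVlt; apply/orP/or_introl/eqP; field; rewrite !gt_eqF.
  by rewrite lerXn2r ?nnegrE // (le_trans ler01).
have -> : gexp p (fun G => s * (Y G - m) ^+ 2) = s * (gexp p (fun G => Y G ^+ 2) - m ^+ 2).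
  rewrite gexpZ; congr (_ * _).
  transitivity (gexp p (fun G => (Y G ^+ 2 + (- (2 * m)) * Y G) + m ^+ 2)).
    by apply: eq_gexp => G _; ring.
  by rewrite !gexpD gexpZ gexp_const EY; ring.
have var := gexp_weighted_fluctuation2 p_sym p01 (fun i => andb_true_intro (conj (a_ge0 i) (a_le i))).
have sum_le : \sum_i a i * (4 * degree_var p i ^+ 2 + 2 * degree_var p i) <= 6 * (\rank p)%:R.
  apply: le_trans (_ : 6 * (\sum_i row_weight p i) <= _); last first.
    by rewrite ler_wpM2l // sum_row_weight.
  rewrite mulr_sumr; apply: ler_sum => i _; rewrite /a [leRHS]mulrC -mulrA.
  rewrite ler_wpM2l ?row_weight_ge0 // mulrC ler_pdivrMr ?exprn_gt0 //.
  have v0 := degree_var_ge0 p01 i; have v1 := degree_var_le p01 i.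
  have t1 := degree_ge1 i; nra.
have var_le : gexp p (fun G => Y G ^+ 2) - m ^+ 2 <= delta^-1 ^+ 3 * (6 * (\rank p)%:R).
  rewrite lerBlDl; apply: le_trans var _; rewrite lerD2l ler_wpM2l //.
  by rewrite exprn_ge0 // invr_ge0 ltW.
apply: le_trans (ler_wpM2l s0 var_le) _.
by rewrite le_eqVlt; apply/orP/or_introl/eqP; rewrite /s; field; rewrite !gt_eqF.
Qed.

Lemma second_order_prob tau : 0 < tau ->
  graph_prob p (fun G => tau / delta <
     \sum_i row_weight p i * relative_fluctuation G i ^+ 4) <=
  4 * (\rank p)%:R / (tau * delta).
Proof.
move=> tau0; pose Y G := \sum_i row_weight p i * relative_fluctuation G i ^+ 4.
have s0 : 0 <= delta / tau by rewrite divr_ge0 // ltW.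
apply: le_trans (_ : gexp p (fun G => delta / tau * Y G) <= _).
  apply: (graph_markov p01) => G _.
    rewrite mulr_ge0 // sumr_ge0 // => i _.
    by rewrite mulr_ge0 ?row_weight_ge0 // -[4%N]/(2 * 2)%N exprM sqr_ge0.
  rewrite -/(Y G) => /ltW h; apply: le_trans (ler_wpM2l s0 h).
  by rewrite le_eqVlt; apply/orP/or_introl/eqP; field; rewrite !gt_eqF.
rewrite gexpZ; have EY : gexp p Y <= \sum_i row_weight p i * (4 / delta ^+ 2).
  rewrite gexp_sum; apply: ler_sum => i _; rewrite gexpZ ler_wpM2l ?row_weight_ge0 //.
  have -> : gexp p (fun G => relative_fluctuation G i ^+ 4) =
      (degree p i ^+ 4)^-1 * gexp p (fun G => fluctuation p i G ^+ 4).
    by rewrite -gexpZ; apply: eq_gexp => G _; rewrite /relative_fluctuation expr_div_n mulrC.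
  have t1 := degree_ge1 i; have t0 := degree_gt0 i.
  have v0 := degree_var_ge0 p01 i; have v1 := degree_var_le p01 i.
  rewrite mulrC ler_pdivrMr ?exprn_gt0 //; apply: le_trans (gexp_fluctuation4 p_sym p01 i) _.
  apply: (@le_trans _ _ (4 * degree p i ^+ 2)); first by nra.
  rewrite -mulrA ler_wpM2l // mulrC ler_pdivlMr ?exprn_gt0 // -[4%N]/(2 + 2)%N exprD.
  by rewrite ler_wpM2l ?sqr_ge0 // lerXn2r // nnegrE ltW.
apply: le_trans (ler_wpM2l s0 EY) _; rewrite -mulr_suml.
apply: le_trans (_ : delta / tau * ((\rank p)%:R * (4 / delta ^+ 2)) <= _).
  by rewrite ler_wpM2l // ler_wpM2r ?sum_row_weight // divr_ge0 ?sqr_ge0.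
by rewrite le_eqVlt; apply/orP/or_introl/eqP; field; rewrite !gt_eqF.
Qed.

(** With this scaling the noise matrix is [sqrt delta C]: entries at most
[1 / sqrt delta], row variances at most 1. *)
Definition noise_scale : 'M[R]_n := \matrix_(i, j)
  (Num.sqrt delta / (Num.sqrt (degree p i) * Num.sqrt (degree p j))).

Lemma noise_scale_sym i j : noise_scale i j = noise_scale j i.
Proof. by rewrite !mxE [X in _ / X]mulrC. Qed.

Lemma noise_scale_le i j : 0 <= noise_scale i j <= (Num.sqrt delta)^-1.
Proof.
have sd0 : 0 < Num.sqrt delta by rewrite sqrtr_gt0.
have sd i' : Num.sqrt delta <= Num.sqrt (degree p i') by rewrite ler_wsqrtr.
rewrite mxE divr_ge0 ?mulr_ge0 ?sqrtr_ge0 //= ler_pdivrMr ?mulr_gt0 ?sqrtr_gt0 //.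
by rewrite mulrC ler_pdivlMr // ler_pM ?(ltW sd0) ?sd.
Qed.

Lemma noise_scale_var i : \sum_j noise_var p noise_scale i j <= 1.
Proof.
have -> : 1 = \sum_j p i j / degree p i.
  by rewrite -mulr_suml -/(degree p i) divff // gt_eqF ?degree_gt0.
apply: ler_sum => j _; rewrite /noise_var mxE expr_div_n exprMn.
rewrite !sqr_sqrtr ?(ltW (degree_gt0 _)) ?(ltW delta0) //.
have := edge_var_le p01 i j; have := edge_var_ge0 p01 i j; rewrite /edge_var => e0 e1.
have le : delta / (degree p i * degree p j) <= (degree p i)^-1.
  rewrite invfM mulrCA ler_piMr ?invr_ge0 ?(ltW (degree_gt0 _)) //.
  by rewrite ler_pdivrMr // mul1r.
rewrite [leLHS]mulrC; apply: ler_pM => //.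
by rewrite divr_ge0 ?mulr_ge0 ?(ltW (degree_gt0 _)) ?(ltW delta0).
Qed.

Lemma laplacian_sym (M : 'M[R]_n) : (forall i j, M i j = M j i) ->
  (laplacian M)^T = laplacian M.
Proof.
move=> sM; rewrite /laplacian -/(normalized M) linearB /= trmx1; congr (_ - _).
by apply/matrixP => i j; rewrite mxE normalized_sym.
Qed.

Lemma adjacency_noise G i j :
  (adjacency R G i j - p i j) / (Num.sqrt (degree p i) * Num.sqrt (degree p j)) =
  (Num.sqrt delta)^-1 * noise p noise_scale G i j.
Proof.
have sd0 : 0 < Num.sqrt delta by rewrite sqrtr_gt0.
by rewrite !mxE; field; rewrite !gt_eqF ?sqrtr_gt0.
Qed.

(** The error [eps] is split in three.  The choice of [eta] makes
[(2 + eps / 6) / (1 - eta) = 2 + eps / 3], so that the noise takes one third;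
the first order term and the remainder take the others. *)
Lemma failure_probability eps s : 0 < eps -> (0 < s)%N -> (0 < \rank p)%N ->
  graph_prob p (fun G => ~~ [forall i : 'I_n,
      `|lambda (laplacian (adjacency R G)) i - lambda (laplacian p) i|
        <= (2 + Num.sqrt (\rank p)%:R + eps) / Num.sqrt delta]) <=
  n%:R * (growth (Num.sqrt delta)^-1 s.*2.+1 / (2 + eps / 6)) ^+ s.*2
  + (n%:R * (2 * expR (- (delta * (eps / (12 + 2 * eps)) ^+ 2 / 8)))
  + (6 * (\rank p)%:R / ((eps / 3) ^+ 2 * delta)
  + 4 * (\rank p)%:R / ((eps / 9) ^+ 2 * delta))).
Proof.
move=> eps0 s0 k0; set k : R := (\rank p)%:R; set eta := eps / (12 + 2 * eps).
have sd0 : 0 < Num.sqrt delta by rewrite sqrtr_gt0.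
have den0 : 0 < 12 + 2 * eps by lra.
have eta0 : 0 < eta by rewrite divr_gt0.
have eta1 : eta <= 2^-1 by rewrite ler_pdivrMr //; lra.
have beta0 : 0 < 2 + eps / 6 by lra.
pose E1 G := ~~ `[< forall x, `|qform (noise p noise_scale G) x|
                    <= (2 + eps / 6) * dotv x x >].
pose E2 G := [exists i, eta * degree p i < `|fluctuation p i G|].
pose E3 G := (k + eps / 3) / delta <
     \sum_i row_weight p i * relative_fluctuation G i ^+ 2.
pose E4 G := (eps / 9) ^+ 2 / delta <
     \sum_i row_weight p i * relative_fluctuation G i ^+ 4.
apply: (@le_trans _ _ (graph_prob p (fun G => E1 G || (E2 G || (E3 G || E4 G))))).
  apply: (le_graph_prob p01) => G sG; apply: contraR.
  rewrite !negb_or negbK => /and4P [/asboolP h1 h2 h3 h4].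
  have Gsym i j : adjacency R G i j = adjacency R G j i.
    by rewrite !mxE (graph_symmetric sG).
  apply/forallP; apply: weyl; rewrite ?laplacian_sym // => x.
  have k1 : 1 <= Num.sqrt k by rewrite -[leLHS]sqrtr1 ler_wsqrtr // ler1n.
  have := @laplacian_perturbation _ _ p p_sym degree_gt0 (adjacency R G)
    (relative_fluctuation G) eta ((2 + eps / 6) / Num.sqrt delta)
    ((Num.sqrt k + eps / 3) / Num.sqrt delta) (eps / 9 / Num.sqrt delta).
  rewrite (ltW eta0) eta1 => /(_ isT).
  rewrite !divr_ge0 ?addr_ge0 ?divr_ge0 ?(ltW eps0) ?(ltW sd0) ?sqrtr_ge0 //.
  move=> /(_ isT isT isT).
  have hb1 i : degree (adjacency R G) i = degree p i * (1 + relative_fluctuation G i).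
    rewrite /relative_fluctuation /fluctuation; field.
    by rewrite gt_eqF.
  have hb2 i : `|relative_fluctuation G i| <= eta.
    rewrite /relative_fluctuation normrM normfV (gtr0_norm (degree_gt0 i)) ler_pdivrMr //.
    by move: h2; rewrite negb_exists => /forallP /(_ i); rewrite -leNgt.
  move=> /(_ hb1 hb2); set C := \matrix_(_, _) _.
  have -> : C = (Num.sqrt delta)^-1 *: noise p noise_scale G.
    by apply/matrixP => i j; rewrite mxE adjacency_noise [RHS]mxE.
  have hC y : `|qform ((Num.sqrt delta)^-1 *: noise p noise_scale G) y| <=
      (2 + eps / 6) / Num.sqrt delta * dotv y y.
    rewrite qformZ normrM ger0_norm ?invr_ge0 ?(ltW sd0) //.
    by rewrite [(_ + _) / _]mulrC -mulrA ler_wpM2l ?h1 // invr_ge0 ltW.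
  rewrite !expr_div_n sqr_sqrtr ?(ltW delta0) // => /(_ hC).
  have hY : \sum_i row_weight p i * relative_fluctuation G i ^+ 2 <=
      (Num.sqrt k + eps / 3) ^+ 2 / delta.
    move: h3; rewrite -leNgt => h3; apply: le_trans h3 _.
    rewrite ler_wpM2r ?invr_ge0 ?(ltW delta0) // sqrrD sqr_sqrtr ?ler0n //.
    have : eps / 3 * 1 <= eps / 3 * Num.sqrt k by rewrite ler_wpM2l // divr_ge0 // ltW.
    have := sqr_ge0 (eps / 3); rewrite mulr2n; lra.
  have hZ : \sum_i row_weight p i * relative_fluctuation G i ^+ 4 <=
      eps ^+ 2 / 9 ^+ 2 / delta by move: h4; rewrite -leNgt expr_div_n.
  move=> /(_ hY hZ x) /le_trans; apply; rewrite ler_wpM2r ?dotv_ge0 //.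
  have -> : 1 - eta = (12 + eps) / (12 + 2 * eps) by rewrite /eta; field; rewrite gt_eqF.
  rewrite le_eqVlt; apply/orP/or_introl/eqP; field.
  by rewrite !gt_eqF //; lra.
apply: le_trans (graph_probU p01 _ _) _; apply: lerD.
  exact: (noise_norm_prob noise_scale_sym noise_scale_le noise_scale_var).
apply: le_trans (graph_probU p01 _ _) _; apply: lerD.
  apply: le_trans (graph_prob_exists p01 (fun i G =>
    eta * degree p i < `|fluctuation p i G|)) _.
  rewrite -[n in leRHS]card_ord [leRHS]mulr_natl -sumr_const; apply: ler_sum => i _.
  apply: le_trans (degree_chernoff p_sym p01 i _) _.
    by rewrite eta0 (le_trans eta1) //; lra.
  by rewrite ler_wpM2l // ler_expR lerN2 ler_wpM2r ?invr_ge0 // ler_wpM2r ?sqr_ge0.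
apply: le_trans (graph_probU p01 _ _) _; apply: lerD.
  by apply: first_order_prob; lra.
by apply: second_order_prob; rewrite exprn_gt0 // divr_gt0.
Qed.
End LargeDegrees.
End FailureProbability.

(** * Asymptotics *)

Section Asymptotics.
Context {R : realType}.

Lemma min_degree_le n (p : 'M[R]_n) i : min_degree p <= degree p i.
Proof. exact: bigmin_le. Qed.

Lemma rank_gt0 n (p : 'M[R]_n) : (0 < n)%N -> 0 < min_degree p -> (0 < \rank p)%N.
Proof.
case: n p => // n p _ d0; rewrite lt0n mxrank_eq0; apply: contraTneq d0 => ->.
rewrite -leNgt; apply: le_trans (min_degree_le _ ord0) _.
by rewrite /degree big1 // => j _; rewrite mxE.
Qed.

(** Bound for the ratio between the growth rate per step and the target norm
[2 + eps / 6], valid once the growth rate is below [2 + eps / 12]. *)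
Definition contraction (eps : R) : R := (2 + eps / 12) / (2 + eps / 6).

(** For walks of length [2 s] with [s] about [- ln n / ln (contraction eps)],
[walk_rate eps * ln n] bounds [2 s + 1]. *)
Definition walk_rate (eps : R) : R := 2 * - (ln (contraction eps))^-1 + 3.

(** One summand for each use: positivity of the degrees, growth of walks, Chernoff
bound, and the two moment bounds. *)
Definition degree_threshold (eps : R) : R :=
  1 + (12 * walk_rate eps ^+ 2 / eps) ^+ 2
  + 16 / (eps / (12 + 2 * eps)) ^+ 2 + 6 * (6 / eps) ^+ 3.

(** With [s] chosen as above, the ratio to the power [2 s] is at most [n^-2],
which beats the factor [n] of the trace; the Chernoff bound gains [n^-2] in the
same way. *)
Lemma failure_small n (p : 'M[R]_n) (eps : R) :
  (forall i j, p i j = p j i) -> (forall i j, 0 <= p i j <= 1) -> 0 < eps ->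
  1 <= ln (n%:R : R) ->
  degree_threshold eps * (\rank p)%:R <= min_degree p ->
  degree_threshold eps * ln (n%:R : R) ^+ 4 <= min_degree p ->
  graph_prob p (fun G => ~~ [forall i : 'I_n,
      `|lambda (laplacian (adjacency R G)) i - lambda (laplacian p) i|
        <= (2 + Num.sqrt (\rank p)%:R + eps) / Num.sqrt (min_degree p)]) <=
  3 / n%:R + eps / 2.
Proof.
move=> p_sym p01 eps0 l1 Ak Al.
set delta := min_degree p in Ak Al *; set l := ln _ in l1 Al *.
set A := degree_threshold eps in Ak Al; set k : R := (\rank p)%:R in Ak *.
set rho := contraction eps; set C := walk_rate eps.
have n0 : (0 < n)%N by case: (posnP n) l1 => // n0; rewrite /l n0 ln0 // ler10.
have nl : n%:R = expR l by rewrite /l lnK // posrE ltr0n.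
have b0 : 0 < 2 + eps / 6 by lra.
have rho0 : 0 < rho by rewrite divr_gt0 //; lra.
have rho1 : rho < 1 by rewrite ltr_pdivrMr //; lra.
have lnr : ln rho < 0 by rewrite ln_lt0 // rho0.
pose c := - (ln rho)^-1.
have c0 : 0 < c by rewrite oppr_gt0 invr_lt0.
have CE : C = 2 * c + 3 by [].
have eta0 : 0 < eps / (12 + 2 * eps) by rewrite divr_gt0 //; lra.
have e30 : 0 < eps ^+ 3 by rewrite exprn_gt0.
have [A_ge1 A_walk A_deg A_rank] : [/\ 1 <= A, (12 * C ^+ 2 / eps) ^+ 2 <= A,
    16 / (eps / (12 + 2 * eps)) ^+ 2 <= A & 6 * (6 / eps) ^+ 3 <= A].
  have : 0 <= (12 * C ^+ 2 / eps) ^+ 2 by rewrite sqr_ge0.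
  have : 0 <= 16 / (eps / (12 + 2 * eps)) ^+ 2 by rewrite divr_ge0 ?sqr_ge0.
  have : 0 <= 6 * (6 / eps) ^+ 3.
    by rewrite mulr_ge0 ?exprn_ge0 ?divr_ge0 ?(ltW eps0).
  rewrite /A /degree_threshold -/C.
  move: (_ ^+ 2) (16 / _) (6 * _) => a1 a2 a3 *; split; lra.
have l40 : 0 <= l ^+ 4 by rewrite exprn_ge0 // (le_trans ler01).
have l41 : 1 <= l ^+ 4 by rewrite exprn_ege1.
have delta1 : 1 <= delta.
  apply: le_trans Al; rewrite -[leLHS]mulr1; by apply: ler_pM.
have delta0 : 0 < delta by lra.
have k0 : (0 < \rank p)%N by exact: rank_gt0.
pose s := (Num.truncn (c * l)).+1.
have cl0 : 0 <= c * l by rewrite mulr_ge0 ?(ltW c0) // (le_trans ler01).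
have /andP [s_lo s_hi] := truncn_itv cl0.
have s_le : s%:R <= c * l + 1 by rewrite -natr1 lerD2r.
apply: le_trans (failure_probability p_sym p01 delta1 (min_degree_le p) eps0
  (isT : 0 < s)%N k0) _.
have nexp : n%:R * expR (- (2 * l)) = n%:R^-1.
  by rewrite nl -expRN -expRD; congr expR; ring.
have T1 : n%:R * (growth (Num.sqrt delta)^-1 s.*2.+1 / (2 + eps / 6)) ^+ s.*2
    <= n%:R^-1.
  rewrite -nexp ler_wpM2l //.
  have sd0 : 0 < Num.sqrt delta by rewrite sqrtr_gt0.
  have sd : 12 * C ^+ 2 / eps * l ^+ 2 <= Num.sqrt delta.
    have x0 : 0 <= 12 * C ^+ 2 / eps * l ^+ 2.
      apply: mulr_ge0 (sqr_ge0 l); apply: divr_ge0 (ltW eps0).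
      exact: mulr_ge0 (ler0n _ 12) (sqr_ge0 C).
    rewrite -(ger0_norm x0) -sqrtr_sqr ler_wsqrtr // exprMn -exprM.
    by apply: le_trans Al; rewrite ler_wpM2r.
  have C0 : 0 <= C by rewrite CE; lra.
  have sC : (s.*2.+1)%:R <= C * l.
    rewrite -natr1 -mul2n natrM CE; nra.
  have sq : (s.*2.+1)%:R ^+ 2 <= C ^+ 2 * l ^+ 2.
    by rewrite -exprMn lerXn2r ?nnegrE // (le_trans _ sC).
  have gr : growth (Num.sqrt delta)^-1 s.*2.+1 <= 2 + eps / 12.
    rewrite /growth lerD2l ler_pdivrMr //; apply: le_trans sq _.
    have -> : C ^+ 2 * l ^+ 2 = eps / 12 * (12 * C ^+ 2 / eps * l ^+ 2).
      by field; rewrite gt_eqF.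
    by rewrite ler_wpM2l ?divr_ge0 ?(ltW eps0).
  have gr0 : 0 <= growth (Num.sqrt delta)^-1 s.*2.+1.
    by rewrite /growth addr_ge0 // mulr_ge0 ?sqr_ge0 // invr_ge0 ltW.
  apply: (@le_trans _ _ (rho ^+ s.*2)).
    have ratio0 : 0 <= growth (Num.sqrt delta)^-1 s.*2.+1 / (2 + eps / 6).
      by rewrite divr_ge0 // ltW.
    rewrite lerXn2r // ?nnegrE ?(ltW rho0) // ler_wpM2r // invr_ge0; exact: ltW.
  have rhoK : expR (ln rho) = rho by rewrite lnK // posrE.
  rewrite -rhoK -expRM_natl ler_expR -mul2n natrM.
  have : s%:R * ln rho <= c * l * ln rho by rewrite ler_wnM2r // ltW.
  have -> : c * l * ln rho = - l by rewrite /c; field; rewrite lt_eqF.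
  lra.
have T2 : n%:R * (2 * expR (- (delta * (eps / (12 + 2 * eps)) ^+ 2 / 8)))
    <= 2 / n%:R.
  rewrite -nexp mulrCA ler_wpM2l // ler_wpM2l // ler_expR lerN2.
  rewrite ler_pdivlMr // -ler_pdivrMr ?exprn_gt0 //; apply: le_trans Al.
  have -> : 2 * l * 8 / (eps / (12 + 2 * eps)) ^+ 2 =
    16 / (eps / (12 + 2 * eps)) ^+ 2 * l by ring.
  apply: ler_pM => //; rewrite ?(le_trans ler01 l1) ?divr_ge0 ?sqr_ge0 //.
  by rewrite -[leLHS]expr1 ler_weXn2l.
have kd : 6 * (6 / eps) ^+ 3 * k <= delta.
  by apply: le_trans Ak; rewrite ler_wpM2r.
have k_ge0 : 0 <= k by [].
have T3 : 6 * k / ((eps / 3) ^+ 2 * delta) <= eps / 4.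
  rewrite ler_pdivrMr ?mulr_gt0 ?exprn_gt0 ?divr_gt0 //.
  apply: le_trans (_ : eps / 4 * ((eps / 3) ^+ 2 * (6 * (6 / eps) ^+ 3 * k)) <= _).
    have -> : eps / 4 * ((eps / 3) ^+ 2 * (6 * (6 / eps) ^+ 3 * k)) = 36 * k.
      by field; rewrite gt_eqF.
    by rewrite ler_wpM2r // ler_nat.
  by rewrite ler_wpM2l ?divr_ge0 ?(ltW eps0) // ler_wpM2l ?sqr_ge0.
have T4 : 4 * k / ((eps / 9) ^+ 2 * delta) <= eps / 4.
  rewrite ler_pdivrMr ?mulr_gt0 ?exprn_gt0 ?divr_gt0 //.
  apply: le_trans (_ : eps / 4 * ((eps / 9) ^+ 2 * (6 * (6 / eps) ^+ 3 * k)) <= _).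
    have -> // : eps / 4 * ((eps / 9) ^+ 2 * (6 * (6 / eps) ^+ 3 * k)) = 4 * k.
    by field; rewrite gt_eqF.
  by rewrite ler_wpM2l ?divr_ge0 ?(ltW eps0) // ler_wpM2l ?sqr_ge0.
move: T1 T2 T3 T4; move: (n%:R^-1) (n%:R * _) (n%:R * _) (6 * k / _) (4 * k / _).
move=> *; lra.
Qed.

Local Open Scope classical_set_scope.

(** Diagonal extraction: take for [o1 n] the infimum of the errors [e] admissible
at [n], plus [1 / (n + 1)] because the infimum need not be admissible. *)
Lemma vanishing_error (P : nat -> R -> R) :
  (forall n e, 0 <= P n e <= 1) -> (forall n e e', e <= e' -> P n e <= P n e') ->
  (forall e, 0 < e -> \forall n \near \oo, 1 - e <= P n e) ->
  exists o1 : nat -> R, (o1 n @[n --> \oo] --> (0 : R)) /\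
    (P n (o1 n) @[n --> \oo] --> (1 : R)).
Proof.
move=> P01 Pmono Pnear.
pose S n : set R := [set e | 0 < e /\ 1 - e <= P n e].
have S0 n : S n !=set0.
  by exists 1; split=> //; rewrite subrr; case/andP: (P01 n 1).
have lbS n : lbound (S n) 0 by move=> e [/ltW].
have hlS n : has_lbound (S n) by exists 0.
pose o1 n := inf (S n) + n.+1%:R^-1.
have inf0 n : 0 <= inf (S n) by apply: lb_le_inf.
have o10 n : 0 <= o1 n by rewrite addr_ge0 // invr_ge0.
have o1_lim : o1 n @[n --> \oo] --> (0 : R).
  apply/cvgr0Pnorm_le => e e0.
  have e20 : 0 < e / 2 by rewrite divr_gt0.
  near=> n; rewrite ger0_norm //.
  have : inf (S n) <= e / 2.
    by apply: ge_inf => //; split=> //; near: n; exact: Pnear.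
  have : n.+1%:R^-1 < e / 2.
    by near: n; exact: (near_infty_natSinv_lt (PosNum e20)).
  by rewrite /o1 => h1 h2; apply: le_trans (lerD h2 (ltW h1)) _; rewrite -splitr.
exists o1; split=> //.
have lo n : 1 - o1 n <= P n (o1 n).
  have i0 : (0 : R) < n.+1%:R^-1 by rewrite invr_gt0.
  have [e [e0 Pe] lt_e] := inf_adherent i0 (conj (S0 n) (hlS n)).
  apply: le_trans (Pmono _ _ _ (ltW lt_e)); apply: le_trans Pe.
  by rewrite lerD2l lerN2 ltW.
apply: (@squeeze_cvgr _ _ _ _ (fun n => 1 - o1 n) (fun=> 1)).
- by near=> n; rewrite lo /=; case/andP: (P01 n (o1 n)).
- by rewrite -[X in _ --> X]subr0; apply: cvgB => //; exact: cvg_cst.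
- exact: cvg_cst.
Unshelve. all: by end_near.
Qed.

Lemma ln_nat_ge (A : R) : \forall n \near \oo, A <= ln (n%:R : R).
Proof.
near=> n; have h : expR A <= n%:R by near: n; exact: nbhs_infty_ger.
rewrite -[leLHS](expRK A) ler_ln ?posrE ?expR_gt0 //.
exact: lt_le_trans (expR_gt0 A) h.
Unshelve. all: by end_near.
Qed.

End Asymptotics.

Local Open Scope classical_set_scope.

Theorem corollary1 (R : realType) (p : forall n : nat, 'M[R]_n)
    (p_sym : forall (n : nat) (i j : 'I_n), p n i j = p n j i)
    (p_prob : forall (n : nat) (i j : 'I_n), 0 <= p n i j <= 1)
    (k : nat -> nat) (k_rank : forall n : nat, k n = \rank (p n))
    (delta : nat -> R) (delta_min : forall n : nat, delta n = min_degree (p n))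
    (delta_large : much_larger delta
       (fun n => Num.max (k n)%:R (ln (n%:R : R) ^+ 4))) :
  exists o1 : nat -> R,
    (o1 n @[n --> \oo] --> (0 : R)) /\
    (graph_prob (p n) (fun G => [forall i : 'I_n,
        `|lambda (laplacian (adjacency R G)) i - lambda (laplacian (p n)) i|
          <= (2 + Num.sqrt (k n)%:R + o1 n) / Num.sqrt (delta n)])
      @[n --> \oo] --> (1 : R)).
Proof.
pose good n (e : R) (G : 'M[bool]_n) := [forall i : 'I_n,
  `|lambda (laplacian (adjacency R G)) i - lambda (laplacian (p n)) i|
    <= (2 + Num.sqrt (k n)%:R + e) / Num.sqrt (delta n)].
apply: (@vanishing_error R (fun n e => graph_prob (p n) (good n e))).
- by move=> n e; rewrite graph_prob_ge0 // graph_prob_le1.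
- move=> n e e' ee'; apply: le_graph_prob => // G _ /forallP h.
  apply/forallP => i; apply: le_trans (h i) _.
  by rewrite ler_wpM2r ?invr_ge0 ?sqrtr_ge0 // lerD2l.
move=> e e0.
have A0 : 0 <= degree_threshold e.
  rewrite /degree_threshold; apply: addr_ge0.
    by rewrite addr_ge0 ?divr_ge0 ?sqr_ge0 // addr_ge0 ?sqr_ge0.
  by rewrite mulr_ge0 ?exprn_ge0 ?divr_ge0 ?(ltW e0).
have large : \forall n \near \oo, degree_threshold e <=
    delta n / Num.max (k n)%:R (ln (n%:R : R) ^+ 4).
  by move/cvgryPge : delta_large; apply.
near=> n.
have l1 : 1 <= ln (n%:R : R) by near: n; exact: ln_nat_ge.
have n_big : 6 / e <= n%:R by near: n; exact: nbhs_infty_ger.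
have g0 : 0 < Num.max (k n)%:R (ln (n%:R : R) ^+ 4).
  by rewrite lt_max exprn_gt0 ?orbT // (lt_le_trans ltr01).
have dA : degree_threshold e * Num.max (k n)%:R (ln (n%:R : R) ^+ 4) <= delta n.
  by rewrite -ler_pdivlMr //; near: n.
have n0 : 0 < n%:R :> R by rewrite (lt_le_trans _ n_big) // divr_gt0.
rewrite graph_probC lerD2l lerN2 /good delta_min k_rank.
apply: le_trans (failure_small _ _ e0 l1 _ _) _ => //.
- rewrite -k_rank -delta_min; apply: le_trans dA.
  by rewrite ler_wpM2l // le_max lexx.
- by rewrite -delta_min; apply: le_trans dA; rewrite ler_wpM2l // le_max lexx orbT.
have : 3 / n%:R <= e / 2.
  by rewrite ler_pdivrMr //; move: n_big; rewrite ler_pdivrMr //; lra.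
lra.
Unshelve. all: by end_near.
Qed.
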